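(* Let $A$ be a finite abelian group, $\chi$ a non-degenerate symmetric bicharacter of $A$, $\tau$ a square root of $|A|^{-1}$, and let $\mathcal{C}=\mathcal{TY}(A,\chi,\tau)$ with its canonical pivotal structure. Let $k\ge1$ be an integer. Then there exist an integer $r\ge0$ and $\xi\in\mu_8\cup\{0\}$ such that $$\nu_{2k}(\mathcal{C})=\bigl(2^r+\sqrt{|A/A[k]|}\cdot\xi\bigr)\times|A[k]|,$$ and such that, if $|A|$ is odd, then $r=0$ and $$\xi^2=\begin{cases}+1&\text{if }|A|^{k-1}/|A[k]|\equiv1\pmod4,\\-1&\text{otherwise}.\end{cases}$$
   Context: Everything is over $\mathbb{C}$; groups are written multiplicatively; $A[k]=\{a\in A\mid a^k=1\}$; $\mu_8$ is the set of 8th roots of unity in $\mathbb{C}$. A bicharacter of $A$ is a map $\chi: A\times A\to\mathbb{C}^\times$ multiplicative in each variable; it is symmetric if $\chi(a,b)=\chi(b,a)$, and non-degenerate if $\chi(x,a)=1$ for all $x\in A$ implies $a=1$. For a pivotal fusion category $\mathcal{C}$, $\nu_n(\mathcal{C})=\sum_{V\in\mathrm{Irr}(\mathcal{C})}\nu_n(V)\,\mathrm{pdim}(V)$, where $\mathrm{Irr}(\mathcal{C})$ is a set of representatives of the isomorphism classes of simple objects and $\mathrm{pdim}$ is the pivotal dimension. For $\mathcal{C}=\mathcal{TY}(A,\chi,\tau)$, $\mathrm{Irr}(\mathcal{C})=A\sqcup\{m\}$, $\mathrm{pdim}(a)=1$ for $a\in A$, and $\mathrm{pdim}(m)=\sqrt{|A|}$.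 Tambara-Yamagami category. $\mathcal{TY}(A,\chi,\tau)$ (with $\tau\in\mathbb{R}$, $\tau^2=|A|^{-1}$) is the skeletal $\mathbb{C}$-linear monoidal category whose objects are finite direct sums of elements of $S=A\sqcup\{m\}$, with $\mathrm{Hom}(s,s')=\mathbb{C}$ if $s=s'$ and $0$ otherwise ($s,s'\in S$) and the obvious composition. The tensor product is $a\otimes b=ab$, $a\otimes m=m=m\otimes a$, $m\otimes m=\bigoplus_{x\in A}x$ ($a,b\in A$). The unit object is $1\in A$ with identity unit constraints. The associativity constraint $\Phi_{X,Y,Z}:(X\otimes Y)\otimes Z\to X\otimes(Y\otimes Z)$ is determined by $\Phi_{a,m,b}=\chi(a,b)\,\mathrm{id}_m$, $\Phi_{m,a,m}=(\chi(a,x)\delta_{x,y}\mathrm{id}_x)_{x,y}:\bigoplus_x x\to\bigoplus_y y$, $\Phi_{m,m,m}=(\tau\chi(x,y)^{-1}\mathrm{id}_m)_{x,y}:\bigoplus_{x\in A}m\to\bigoplus_{y\in A}m$, all other $\Phi_{s,t,u}$ ($s,t,u\in S$) being identities. The left dual of $a\in A$ is $a^{-1}$ with identity coevaluation and evaluation; the left dual of $m$ is $m$ with coevaluation the injection $1\to m\otimes m$ and evaluation $\tau^{-1}p$, where $p:m\otimes m\to1$ is the projection. The bidual functor is the identity, and the canonical pivotal structure is $j_a=\mathrm{id}_a$ ($a\in A$), $j_m=\mathrm{sgn}(\tau)\,\mathrm{id}_m$. Frobenius-Schur indicators. Let $\mathcal{C}$ be a $\mathbb{C}$-linear rigid monoidal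 category with pivotal structure $j:\mathrm{id}\to(-)^{**}$, coevaluations $d_V:1\to V\otimes V^*$ and evaluations $b_V:V^*\otimes V\to 1$. Put $V^{\otimes0}=1$, $V^{\otimes 1}=V$, $V^{\otimes n}=V\otimes V^{\otimes(n-1)}$ for $n\ge2$. Let $A^X_{Y,Z}:\mathrm{Hom}(X,Y\otimes Z)\to\mathrm{Hom}(Y^*\otimes X,Z)$ and $B^{X,Y}_Z:\mathrm{Hom}(X\otimes Y,Z)\to\mathrm{Hom}(X,Z\otimes Y^* )$ be the standard duality isomorphisms (up to associativity, $f\mapsto(b_Y\otimes\mathrm{id}_Z)(\mathrm{id}_{Y^*}\otimes f)$ and $g\mapsto(g\otimes\mathrm{id}_{Y^*})(\mathrm{id}_X\otimes d_Y)$). Define the linear automorphism $E_V^{(n)}$ of $\mathrm{Hom}(1,V^{\otimes n})$ by $E_V^{(n)}(f)=\Phi\circ(\mathrm{id}_{V^{\otimes(n-1)}}\otimes j_V^{-1})\circ B^{1,V^*}_{V^{\otimes(n-1)}}(A^1_{V,V^{\otimes(n-1)}}(f))$, where $\Phi:V^{\otimes(n-1)}\otimes V\to V^{\otimes n}$ is the associativity isomorphism. The $n$-th Frobenius-Schur indicator is $\nu_n(V)=\mathrm{Tr}(E_V^{(n)})$. *)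

(* Defs.v *)
From HB Require Import structures.
From mathcomp Require Import all_boot all_order all_algebra all_fingroup.
From mathcomp Require Import all_solvable reals complex.
Set Implicit Arguments.
Unset Strict Implicit.
Unset Printing Implicit Defensive.
Import Order.TTheory GRing.Theory Num.Theory.
Local Open Scope ring_scope.

(* Trace of a linear endomorphism, in the library's basis of the whole space. *)
Definition endo_trace (K : fieldType) (V : vectType K) (E : V -> V) : K :=
  \sum_i coord (vbasis {:V}) i (E (vbasis {:V})`_i).

(* The structure maps of a K-linear rigid monoidal category with a pivotal
   structure. The names ending in V are the inverses of the constraints.
   The axioms are not part of the record: indicators and pivotal dimensions
   are expressions in these maps alone. [lev] and [lcoev] are the evaluation
   V* (x) V -> 1 and the coevaluation 1 -> V (x) V* of the left dual. *)
Record pivotal_data (K : fieldType) := PivotalData {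
  ob :> Type;
  hom : ob -> ob -> vectType K;
  idm : forall X, hom X X;
  hcomp : forall X Y Z, hom Y Z -> hom X Y -> hom X Z;
  tens : ob -> ob -> ob;
  tensm : forall X X' Y Y', hom X X' -> hom Y Y' -> hom (tens X Y) (tens X' Y');
  unit_ob : ob;
  assoc : forall X Y Z, hom (tens (tens X Y) Z) (tens X (tens Y Z));
  assocV : forall X Y Z, hom (tens X (tens Y Z)) (tens (tens X Y) Z);
  lunit : forall X, hom (tens unit_ob X) X;
  lunitV : forall X, hom X (tens unit_ob X);
  runit : forall X, hom (tens X unit_ob) X;
  runitV : forall X, hom X (tens X unit_ob);
  ldual : ob -> ob;
  lcoev : forall V, hom unit_ob (tens V (ldual V));
  lev : forall V, hom (tens (ldual V) V) unit_ob;
  piv : forall V, hom V (ldual (ldual V));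
  pivV : forall V, hom (ldual (ldual V)) V }.

Arguments idm {K} _ X.
Arguments unit_ob {K} _.
Arguments hom {K} _ X Y.

Section Indicators.

Variables (K : fieldType) (C : pivotal_data K).
Implicit Types V W X Y Z : C.

Local Notation "g \oc f" := (hcomp g f) (at level 50, left associativity).
Local Notation "X *o Y" := (tens X Y) (at level 40, left associativity).
Local Notation "f *h g" := (tensm f g) (at level 40, left associativity).

Fixpoint tpow V n : C :=
  match n with
  | 0 => unit_ob C
  | n'.+1 => match n' with 0 => V | _.+1 => V *o tpow V n' end
  end.

(* V^(n+1) = V (x) V^n holds on the nose except for n = 0, where it is the
   unit constraint V = V (x) 1. *)
Definition tpowS V n : hom C (tpow V n.+1) (V *o tpow V n) :=
  match n with 0 => runitV V | n'.+1 => idm C (V *o tpow V n'.+1) end.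

Fixpoint tpow_assoc V n : hom C (tpow V n *o V) (tpow V n.+1) :=
  match n with
  | 0 => lunit V
  | n'.+1 =>
    match n' return hom C (tpow V n' *o V) (tpow V n'.+1) ->
                    hom C (tpow V n'.+1 *o V) (tpow V n'.+2) with
    | 0 => fun=> idm C (V *o V)
    | n''.+1 => fun Phi => (idm C V *h Phi) \oc assoc V (tpow V n''.+1) V
    end (tpow_assoc V n')
  end.

Definition dualA X Y Z (f : hom C X (Y *o Z)) : hom C (ldual Y *o X) Z :=
  lunit Z \oc (lev Y *h idm C Z) \oc assocV (ldual Y) Y Z
          \oc (idm C (ldual Y) *h f).

Definition dualB X Y Z (g : hom C (X *o Y) Z) : hom C X (Z *o ldual Y) :=
  (g *h idm C (ldual Y)) \oc assocV X Y (ldual Y)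
          \oc (idm C X *h lcoev Y) \oc runitV X.

(* The map E_V^(n+1) of Hom(1, V^(n+1)); the two unit constraints in the middle
   identify the source V* (x) 1 of dualA f with 1 (x) V*. *)
Definition FS_map V n (f : hom C (unit_ob C) (tpow V n.+1)) :
    hom C (unit_ob C) (tpow V n.+1) :=
  tpow_assoc V n \oc (idm C (tpow V n) *h pivV V)
    \oc dualB (dualA (tpowS V n \oc f) \oc runitV (ldual V) \oc lunit (ldual V)).

(* The n-th indicator, meaningful for n > 0. *)
Definition FS_ind n V : K := if n is n'.+1 then endo_trace (@FS_map V n') else 0.

(* For a simple unit object, End(1) is the line spanned by the identity, so
   the scalar by which the closed loop of V acts is the trace of that action. *)
Definition pdim V : K :=
  endo_trace (fun g : hom C (unit_ob C) (unit_ob C) =>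
           lev (ldual V) \oc (piv V *h idm C (ldual V)) \oc lcoev V \oc g).

End Indicators.

Section Bicharacter.

Variables (A : finGroupType) (K : fieldType) (chi : A -> A -> K).

Definition bicharacter : Prop :=
  [/\ forall a b, chi a b != 0,
      forall a b c, chi (a * b)%g c = chi a c * chi b c
    & forall a b c, chi a (b * c)%g = chi a b * chi a c].

Definition symmetric_bichar : Prop := forall a b, chi a b = chi b a.

Definition nondegenerate_bichar : Prop :=
  forall a, (forall x, chi x a = 1) -> a = 1%g.

End Bicharacter.

Section TambaraYamagami.

Variables (A : finGroupType) (K : numClosedFieldType).
Variables (chi : A -> A -> K) (tau : K).

(* The simple objects: [Some a] is a \in A, [None] is m. *)
Local Notation S := (option A).

Definition in_tens (s t u : S) : bool :=
  match s, t with
  | Some a, Some b => u == Some (a * b)%g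
  | None, None => u != None
  | _, _ => u == None
  end.

(* Finite direct sums of simple objects, as finite families. *)
Record fsum := Fsum { fidx : finType; flab : fidx -> S }.

Implicit Types (s t u v e f : S) (X Y Z : fsum).

(* Morphisms are matrices whose (i, j) entry is in Hom (X_i, Y_j), hence exists
   only if X_i = Y_j. *)
Definition fhom X Y : vectType K :=
  {ffun {p : fidx X * fidx Y | flab p.1 == flab p.2} -> K^o}.

Definition fmx X Y (F : fidx X -> fidx Y -> K) : fhom X Y :=
  [ffun p => F (val p).1 (val p).2].
Arguments fmx {X Y} & F.

Definition entry X Y (f : fhom X Y) (i : fidx X) (j : fidx Y) : K :=
  oapp f 0 (insub (i, j)).

Definition fid X : fhom X X := fmx (fun i j => (i == j)%:R).

Definition fcomp X Y Z (g : fhom Y Z) (f : fhom X Y) : fhom X Z :=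
  fmx (fun i k => \sum_j entry f i j * entry g j k).

Definition fsimple s : fsum := @Fsum unit (fun=> s).

(* One summand u of X (x) Y for each pair of summands X_i, Y_j and each
   simple summand u of X_i (x) Y_j. *)
Definition tidx X Y : finType :=
  {p : fidx X * fidx Y * S | in_tens (flab p.1.1) (flab p.1.2) p.2}.

Definition ftens X Y : fsum := @Fsum (tidx X Y) (fun p => (val p).2).

Definition ftensm X X' Y Y' (f : fhom X X') (g : fhom Y Y') :
    fhom (ftens X Y) (ftens X' Y') :=
  fmx (fun (p : tidx X Y) (q : tidx X' Y') =>
         let: (i, j, u) := val p in let: (i', j', u') := val q in
         entry f i i' * entry g j j' * (u == u')%:R).

(* The component of the associativity constraint from the summand v of e (x) u,
   for the summand e of s (x) t, to the summand v of s (x) f, for the summand f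
   of t (x) u; and that of its inverse. Unless s = t = u = m, the
   summands e and f are determined by s, t, u and v, so that an identity
   constraint has all its components equal to 1. The values 0 are never used:
   they are at incompatible e, f or v. *)
Definition Fsym s t u e f v : K :=
  match s, t, u with
  | Some a, None, Some b => chi a b
  | None, Some a, None => if v is Some x then chi a x else 0
  | None, None, None =>
      if (e, f) is (Some x, Some y) then tau * (chi x y)^-1 else 0
  | _, _, _ => 1
  end.

Definition FsymV s t u e f v : K :=
  match s, t, u with
  | Some a, None, Some b => (chi a b)^-1
  | None, Some a, None => if v is Some x then (chi a x)^-1 else 0
  | None, None, None =>
      if (e, f) is (Some x, Some y) then tau * chi x y else 0
  | _, _, _ => 1
  end.

Definition fassoc X Y Z : fhom (ftens (ftens X Y) Z) (ftens X (ftens Y Z)) :=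
  fmx (fun (p : tidx (ftens X Y) Z) (q : tidx X (ftens Y Z)) =>
    let: (ije, k, v) := val p in let: (i, j, e) := val (ije : tidx X Y) in
    let: (i', jkf, v') := val q in let: (j', k', f) := val (jkf : tidx Y Z) in
    [&& i == i', j == j', k == k' & v == v']%:R
      * Fsym (flab i) (flab j) (flab k) e f v).

Definition fassocV X Y Z : fhom (ftens X (ftens Y Z)) (ftens (ftens X Y) Z) :=
  fmx (fun (q : tidx X (ftens Y Z)) (p : tidx (ftens X Y) Z) =>
    let: (ije, k, v) := val p in let: (i, j, e) := val (ije : tidx X Y) in
    let: (i', jkf, v') := val q in let: (j', k', f) := val (jkf : tidx Y Z) in
    [&& i == i', j == j', k == k' & v == v']%:R
      * FsymV (flab i) (flab j) (flab k) e f v).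

Definition fone : fsum := fsimple (Some 1%g).

(* 1 (x) X has the same family of summands as X, up to renaming the indices. *)
Definition flunit X : fhom (ftens fone X) X :=
  fmx (fun (p : tidx fone X) i => ((val p).1.2 == i)%:R).
Definition flunitV X : fhom X (ftens fone X) :=
  fmx (fun i (p : tidx fone X) => ((val p).1.2 == i)%:R).
Definition frunit X : fhom (ftens X fone) X :=
  fmx (fun (p : tidx X fone) i => ((val p).1.1 == i)%:R).
Definition frunitV X : fhom X (ftens X fone) :=
  fmx (fun i (p : tidx X fone) => ((val p).1.1 == i)%:R).

Definition fdual X : fsum := @Fsum (fidx X) (fun i => omap (fun a => a^-1%g) (flab i)).

Definition fcoev X : fhom fone (ftens X (fdual X)) :=
  fmx (fun _ (p : tidx X (fdual X)) => ((val p).1.1 == (val p).1.2 :> fidx X)%:R).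

Definition fev X : fhom (ftens (fdual X) X) fone :=
  fmx (fun (p : tidx (fdual X) X) _ => ((val p).1.1 == (val p).1.2 :> fidx X)%:R
                  * (if flab (val p).1.2 is None then tau^-1 else 1)).

Definition fpiv X : fhom X (fdual (fdual X)) :=
  fmx (fun i (j : fidx X) =>
         (i == j)%:R * (if flab i is None then Num.sg tau else 1)).
Definition fpivV X : fhom (fdual (fdual X)) X :=
  fmx (fun (i : fidx X) j =>
         (i == j)%:R * (if flab j is None then (Num.sg tau)^-1 else 1)).

Definition TY : pivotal_data K := {|
  ob := fsum; hom := fhom; idm := fid; hcomp := fcomp;
  tens := ftens; tensm := ftensm; unit_ob := fone;
  assoc := fassoc; assocV := fassocV;
  lunit := flunit; lunitV := flunitV; runit := frunit; runitV := frunitV;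
  ldual := fdual; lcoev := fcoev; lev := fev; piv := fpiv; pivV := fpivV |}.

Definition TY_ind n : K :=
  \sum_(s : S) FS_ind n (fsimple s : TY) * pdim (fsimple s : TY).

End TambaraYamagami.

Section Checks.

Variables (A : finGroupType) (K : numClosedFieldType).
Variables (chi : A -> A -> K) (tau : K).
Hypotheses (chiB : bicharacter chi) (chiS : symmetric_bichar chi).
Hypotheses (chiN : nondegenerate_bichar chi) (tauE : tau ^+ 2 = #|A|%:R^-1).

Lemma bichar_sum (x : A) : \sum_y chi x y = #|A|%:R * (x == 1%g)%:R.
Proof.
have [n0 Ml Mr] := chiB.
have chi1 y : chi 1%g y = 1.
  by apply: (mulfI (n0 1%g y)); rewrite -Ml mul1g mulr1.
have [->|x1] := eqVneq x 1%g.
  by under eq_bigr do rewrite chi1; rewrite sumr_const mulr1.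
have [y0 y0P] : exists y, chi y x != 1.
  case: (pickP (fun y => chi y x != 1)) => [y yP|N]; first by exists y.
  by case/eqP: x1; apply: chiN => y; have /negbFE/eqP := N y.
apply/eqP; rewrite mulr0; have: (1 - chi x y0) * \sum_y chi x y = 0.
  rewrite mulrBl mul1r mulr_sumr (reindex_inj (mulgI y0)) /=.
  by under eq_bigr do rewrite Mr; rewrite subrr.
by move/eqP; rewrite mulf_eq0 subr_eq0 chiS eq_sym (negPf y0P).
Qed.

(* For fixed s, t, u and v, the matrix [FsymV] is the inverse of [Fsym]. *)
Lemma FsymK (s t u e e' v : option A) :
  in_tens s t e -> in_tens e u v -> in_tens s t e' -> in_tens e' u v ->
  \sum_(f | in_tens t u f && in_tens s f v)
     Fsym chi tau s t u e f v * FsymV chi tau s t u e' f v = (e == e')%:R.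
Proof.
have [n0 Ml Mr] := chiB.
have pick1 (f0 : option A) (P : pred (option A)) (G : option A -> K) b :
    P =1 pred1 f0 -> G f0 = b%:R -> \sum_(f | P f) G f = b%:R.
  by move=> P1 <-; rewrite (big_pred1 f0).
have eqV (x y z : A) : (Some (x * y)%g == Some z) = (Some y == Some (x^-1 * z)%g).
  by rewrite !(inj_eq Some_inj) (can2_eq (mulKg x) (mulKVg x)).
case: s t u => [a|] [b|] [c|] /=.
- move=> /eqP-> /eqP-> /eqP-> _; apply: (pick1 (Some (b * c)%g)).
    by move=> [f|] //=; rewrite -[_ == Some (b * c)%g]andbT; case: eqP => // -[->]; rewrite mulgA eqxx.
  by rewrite mulr1 eqxx.
- move=> /eqP-> /eqP-> /eqP-> _; apply: (pick1 None); first by case.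
  by rewrite mulr1 eqxx.
- move=> /eqP-> /eqP-> /eqP-> _; apply: (pick1 None); first by case.
  by rewrite mulfV ?eqxx.
- move=> /eqP-> /= v0 /eqP-> _; case: v v0 => // v _; apply: (pick1 (Some (a^-1 * v)%g)).
    by case=> [f|] //=; rewrite [Some v == _]eq_sym eqV.
  by rewrite mulr1 eqxx.
- move=> /eqP-> /eqP-> /eqP-> _; apply: (pick1 (Some (b * c)%g)).
    by case=> [f|] //=; rewrite andbT.
  by rewrite mulr1 eqxx.
- move=> /eqP-> /= v0 /eqP-> _; case: v v0 => // v _; apply: (pick1 None); first by case.
  by rewrite mulfV ?eqxx.
- case: e => // e _ /eqP->; case: e' => // e' _ /eqP[/mulIg<-].
  by apply: (pick1 None); [case|rewrite mulr1 eqxx].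
- case: e => // e _ /eqP->; case: e' => // e' _ _.
  have -> : (Some e == Some e') = (e' * e^-1 == 1)%g by rewrite (inj_eq Some_inj) eq_sym eq_mulgV1.
  have cV x y : chi x^-1%g y = (chi x y)^-1.
    apply: (mulfI (n0 x y)); rewrite -Ml mulgV mulfV //.
    by apply: (mulfI (n0 1%g y)); rewrite -Ml mul1g mulr1.
  have cardA : (#|A|%:R : K) != 0 by rewrite pnatr_eq0 -lt0n; apply/card_gt0P; exists e.
  transitivity (\sum_y #|A|%:R^-1 * chi (e' * e^-1)%g y); last first.
    by rewrite -mulr_sumr bichar_sum mulKf.
  rewrite (reindex_onto (fun y => Some y) (fun f => odflt e f)) /=; last by case.
  apply: eq_big => [y|y _] /=; first by rewrite !eqxx.
  by rewrite Ml cV -tauE expr2 mulrACA [(chi e y)^-1 * _]mulrC.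
Qed.

Lemma cardA_gt0 : (0 < #|A|)%N. Proof. by apply/card_gt0P; exists 1%g. Qed.

Lemma sg_tauV : Num.sg tau * tau^-1 = sqrtC #|A|%:R.
Proof.
have N0 : 0 < sqrtC (#|A|%:R : K) by rewrite sqrtC_gt0 ltr0n cardA_gt0.
have : tau ^+ 2 = (sqrtC #|A|%:R)^-1 ^+ 2 by rewrite exprVn sqrtCK.
move/eqP; rewrite eqf_sqr => /orP[] /eqP->.
  by rewrite gtr0_sg ?invr_gt0 // mul1r invrK.
by rewrite ltr0_sg ?oppr_lt0 ?invr_gt0 // invrN invrK mulN1r opprK.
Qed.

Local Notation C := (TY chi tau).
Local Notation X_ s := (fsimple s).
Local Notation loop s :=
  (fcomp (fcomp (fev tau (fdual (X_ s)))
                (ftensm (fpiv tau (X_ s)) (fid K (fdual (X_ s)))))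
         (fcoev K (X_ s))).

Lemma entry_fmx (X Y : fsum A) F (i : fidx X) (j : fidx Y) :
  entry (@fmx _ K X Y F) i j = if flab i == flab j then F i j else 0.
Proof.
rewrite /entry; case: insubP => [p /= -> vp|/negPf/= ->] //=.
by rewrite ffunE [val p]vp.
Qed.

Lemma endo_trace_scale (F : fieldType) (V : vectType F) (c : F) (E : V -> V) :
  (forall v, E v = c *: v) -> endo_trace E = c * (\dim {:V})%:R.
Proof.
move=> Ec; rewrite /endo_trace mulr_natr -[X in _ *+ X]card_ord -sumr_const.
apply: eq_bigr => i _; rewrite Ec linearZ /= coord_free ?eqxx ?mulr1 //.
exact: basis_free (vbasisP _).
Qed.

Lemma pdim_scal (s : option A) (c : K) :
  (forall i j, entry (loop s) i j = c) ->
  pdim (fsimple s : C) = c.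
Proof.
move=> H; rewrite /pdim (@endo_trace_scale _ _ c).
  rewrite dimvf /=.
  have -> : dim (fhom K (fone A) (fone A)) = 1%N.
    rewrite /dim /= muln1 card_sig (eq_card (B := predT)) => [|p]; last first.
      by rewrite !inE eqxx.
    by rewrite card_prod card_unit.
  by rewrite mulr1.
move=> g; apply/ffunP => -[[[] []] p]; rewrite !ffunE /=.
rewrite (big_pred1 tt) => [|[]] //=; rewrite H mulrC.
rewrite [entry g _ _]/entry; case: insubP => [q _ qE|/negP[]//].
by congr (_ * g _); apply: val_inj.
Qed.

Lemma pdim_loop (s : option A) i j : 
  entry (loop s) i j = if s is None then sqrtC #|A|%:R else 1.
Proof.
have P0 : in_tens (@flab A (fsimple s) tt) (@flab A (fdual (fsimple s)) tt) (Some 1%g).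
  by case: s i j => //= a; rewrite mulgV.
have Q0 : in_tens (@flab A (fdual (fdual (fsimple s))) tt) (@flab A (fdual (fsimple s)) tt) (Some 1%g).
  by case: s i j P0 => //= a; rewrite invgK mulgV.
pose p0 : tidx (fsimple s) (fdual (fsimple s)) := exist _ (tt, tt, Some 1%g) P0.
pose q0 : tidx (fdual (fdual (fsimple s))) (fdual (fsimple s)) :=
  exist _ (tt, tt, Some 1%g) Q0.
rewrite /fcomp entry_fmx eqxx (bigD1 p0) //= big1 ?addr0; last first.
  move=> [[[[] []] u] up] /=; rewrite -val_eqE /= => ne.
  rewrite [entry (fcoev _ _) _ _]entry_fmx /=; case: eqP => [u1|]; last by rewrite mul0r.
  by case/eqP: ne; rewrite -u1.
rewrite [entry (fcoev _ _) _ _]entry_fmx /= eqxx mul1r entry_fmx /= eqxx.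
rewrite (bigD1 q0) //= big1 ?addr0; last first.
  move=> [[[[] []] u] up] /=; rewrite -val_eqE /= => ne.
  rewrite [entry (fev _ _) _ _]entry_fmx /=; case: eqP => [u1|]; last by rewrite mulr0.
  by case/eqP: ne; rewrite u1.
rewrite [entry (fev _ _) _ _]entry_fmx /= !eqxx mul1r.
rewrite [entry (ftensm _ _) _ _]entry_fmx /= !eqxx mulr1 !entry_fmx /= !eqxx.
have -> : (s == omap (fun a => a^-1)%g (omap (fun a => a^-1)%g s)).
  by case: s {P0 Q0 p0 q0 i j} => //= a; rewrite invgK.
by rewrite mulr1 mul1r; case: s {P0 Q0 p0 q0 i j} => [a|] /=; rewrite ?mulr1 ?sg_tauV.
Qed.

Lemma pdim_TY (s : option A) :
  pdim (fsimple s : C) = if s is None then sqrtC #|A|%:R else 1.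
Proof. exact/pdim_scal/pdim_loop. Qed.

End Checks.

(* Main.v *)
Require Import Defs.
From mathcomp Require Import all_boot all_order all_algebra all_fingroup.
From mathcomp Require Import all_solvable reals complex.
From mathcomp Require Import ring zify.
Import Order.TTheory GRing.Theory Num.Theory.
Local Open Scope ring_scope.
Set Implicit Arguments.
Unset Strict Implicit.
Unset Printing Implicit Defensive.

(** Write N = #|A| and let N_k be the order of the k-torsion A[k].

    The indicators. The rotation operator on Hom (1, V^n) has the coefficients of
    the associativity isomorphism from V^(n-1) (x) V to V^n, up to the sign of the
    pivotal structure ([trace_rotation]), and the diagonal coefficients of this
    isomorphism satisfy a recursion of their own ([diag_entry_rec]). It gives
    nu_2k (a) = 1 if a ^ 2k = 1 and 0 otherwise, and, with k = j + 1,
    nu_2k (m) = sgn (tau) tau ^ j S, where S is the sum over x in A ^ j of the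
    product of the chi (x_i, x_(i-1)) / chi (x_i, x_i), with x_0 = 1 ([path_sum],
    at y = 1). Hence nu_2k (C) = #|A[2k]| + tau^-1 tau ^ j S ([TY_indE]). The first
    term is 2 ^ r N_k because A[2k] / A[k] has exponent at most 2.

    The modulus of S. The path sums S (y) with a free end point y satisfy a
    Plancherel formula ([path_sum_norm]), and a translation formula expressing
    S (y a ^ k) by S (y) ([path_sum_shift]). If the character
    a |-> chi (a, a) ^ (k (k - 1) / 2) of A[k] is not trivial, then S = S (1) = 0;
    otherwise S (y) is supported on the k-th powers and has constant modulus
    there, so that |S| ^ 2 = P, where P = N ^ j N_k ([path_sum1_norm]).

    The argument of S. Since - 1 is a sum of four squares mod N ([sum4sq]), some
    quaternion acts on A ^ 4 as an isometry between the orthogonal sums of four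
    copies of chi^-1 and of chi. Hence S ^ 4 is real ([path_sum1_quartic]) and
    S ^ 8 = |S| ^ 8, so that xi = tau^-1 tau ^ j S / (sqrt (N / N_k) N_k), whose
    square is S ^ 2 / P, is 0 or an 8th root of unity.

    Odd order. The character of A[k] above is trivial and S is not 0. Pairing x
    with its inverse shows that S is congruent to 1 modulo twice an algebraic
    integer ([path_sum1_odd]). So S ^ 4 = 1 mod 8, which leaves S ^ 4 = P ^ 2 only,
    and S ^ 2 = 1 mod 4, which leaves S ^ 2 = P if P = 1 mod 4 and
    S ^ 2 = - P otherwise ([odd_sqr]). Finally P and N ^ j / N_k differ by the factor
    N_k ^ 2, which is 1 mod 4. *)

(** * Sums of four squares modulo n *)

Section FourSquares.

Local Open Scope nat_scope.

(** Pigeonhole: with p = 2m - 1, the m residues a ^ 2 and the m residues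
    - (b ^ 2 + 1), for a and b below m, cannot all be distinct mod p. *)
Lemma sum2sq_prime p : prime p -> odd p -> exists a b, p %| a ^ 2 + b ^ 2 + 1.
Proof.
move=> pp op; have p1 := prime_gt1 pp.
pose m := p./2.+1.
have mE : p = m + m - 1 by have := odd_double_half p; rewrite /m op -addnn; lia.
have mltp (i : 'I_m) : i < p by case: i => i /=; lia.
pose f (x : 'I_m + 'I_m) : 'I_p :=
  match x with
  | inl a => Ordinal (ltn_pmod (a ^ 2) (prime_gt0 pp))
  | inr b => Ordinal (ltn_pmod (p.-1 * (b ^ 2 + 1)) (prime_gt0 pp))
  end.
have : ~~ injectiveb f.
  apply/negP => /injectiveP/leq_card; rewrite card_sum !card_ord; lia.
have sqI (a b : 'I_m) : a ^ 2 = b ^ 2 %[mod p] -> a = b.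
  wlog ab : a b / a <= b.
    by case: (leqP a b) => [|/ltnW] ab H e; [exact: H|apply/esym/H].
  move=> /esym/eqP; rewrite eqn_mod_dvd ?leq_sqr // subn_sqr Euclid_dvdM //.
  case/orP => d; apply: val_inj => /=.
    have [//|ne] := eqVneq (val a) (val b).
    have := dvdn_leq _ d; have := ltn_ord a; have := ltn_ord b; lia.
  have [->|ne] := eqVneq (val a) (val b); first by [].
  have := dvdn_leq _ d; have := ltn_ord a; have := ltn_ord b; lia.
case/injectivePn => x [y ne] /(congr1 val) /=.
have cross (a b : 'I_m) : a ^ 2 = p.-1 * (b ^ 2 + 1) %[mod p] -> p %| a ^ 2 + b ^ 2 + 1.
  move=> e; rewrite /dvdn -addnA -modnDml e modnDml.
  by rewrite -mulSnr prednK ?prime_gt0 // modnMr.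
case: x y ne => [a|a] [b|b] ne /=.
- by move/sqI => ab; rewrite ab eqxx in ne.
- by move/cross => d; exists a, b.
- by move/esym/cross => d; exists b, a.
- move=> e.
  have : a ^ 2 = b ^ 2 %[mod p].
    apply/eqP; rewrite -(eqn_modDr 1); apply/eqP.
    have /(congr1 (fun t => p.-1 * t %% p)) := e.
    rewrite !modnMmr !mulnA => e2.
    have pm : p.-1 * p.-1 = 1 %[mod p].
      have -> : p.-1 * p.-1 = (p - 2) * p + 1.
        by move: p1; case: (p) => [|[|q]] // _; rewrite subn2 /=; ring.
      by rewrite modnMDl.
    by move: e2; rewrite -modnMml pm modnMml mul1n -[X in _ = X]modnMml pm modnMml mul1n.
  by move/sqI => ab; rewrite ab eqxx in ne.
Qed.

Lemma sum4sq_congr m a b c d a' b' c' d' :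
  a = a' %[mod m] -> b = b' %[mod m] -> c = c' %[mod m] -> d = d' %[mod m] ->
  m %| a ^ 2 + b ^ 2 + c ^ 2 + d ^ 2 + 1 ->
  m %| a' ^ 2 + b' ^ 2 + c' ^ 2 + d' ^ 2 + 1.
Proof.
have sq x x' : x = x' %[mod m] -> x ^ 2 = x' ^ 2 %[mod m].
  by move=> e; rewrite -modnXm e modnXm.
have add x x' y y' : x = x' %[mod m] -> y = y' %[mod m] -> x + y = x' + y' %[mod m].
  by move=> e f; rewrite -modnDm e f modnDm.
move=> ha hb hc hd; rewrite /dvdn.
suff -> : a ^ 2 + b ^ 2 + c ^ 2 + d ^ 2 + 1 = a' ^ 2 + b' ^ 2 + c' ^ 2 + d' ^ 2 + 1 %[mod m] by [].
have hab := add _ _ _ _ (sq _ _ ha) (sq _ _ hb).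
exact: (add _ _ _ _ (add _ _ _ _ (add _ _ _ _ hab (sq _ _ hc)) (sq _ _ hd))).
Qed.

(** Induction on n, splitting off its smallest prime factor p: a solution mod
    n %/ p is combined with one mod p by the Chinese remainder theorem if p does
    not divide n %/ p, and is lifted by Hensel's method otherwise. *)
Lemma sum2sq_odd n : odd n -> exists a b, n %| a ^ 2 + b ^ 2 + 1.
Proof.
elim/ltn_ind: n => n IH on.
have [n1|n1] := leqP n 1.
  by exists 0, 0; have -> : n = 1 by case: n n1 on {IH} => [|[|]].
set p := pdiv n; have pp : prime p := pdiv_prime n1.
have /dvdnP[m nE] : p %| n := pdiv_dvd n.
have [om op] : odd m /\ odd p by move: on; rewrite nE oddM => /andP[].
have [|a [b dm]] := IH m _ om.
  by rewrite nE ltn_Pmulr ?prime_gt1 // odd_gt0.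
have [pm|pm] := boolP (p %| m); last first.
  have cop : coprime m p by rewrite coprime_sym prime_coprime.
  have [c [d dp]] := sum2sq_prime pp op.
  exists (chinese m p a c), (chinese m p b d).
  have z2 x y : x ^ 2 + y ^ 2 + 1 = x ^ 2 + y ^ 2 + 0 ^ 2 + 0 ^ 2 + 1 by rewrite !addn0.
  rewrite nE Gauss_dvd // !z2; apply/andP; split.
    by apply: (@sum4sq_congr m a b 0 0); rewrite ?chinese_modl // -z2.
  by apply: (@sum4sq_congr p c d 0 0); rewrite ?chinese_modr // -z2.
(* Now p divides m, so p divides at most one of a and b. *)
wlog pa : a b dm / ~~ (p %| a).
  move=> H; have [pa|pa] := boolP (p %| a); last exact: (H a b).
  have [||c [d]] := H b a; first by rewrite [b ^ 2 + _]addnC.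
    apply: contraL pa => pb; apply/negP => pa.
    have := dvdn_trans pm dm; rewrite dvdn_addr; last by rewrite dvdn_add // dvdn_mulr.
    by rewrite dvdn1 => /eqP p1; rewrite p1 in pp.
  by exists c, d.
have /dvdnP[t tE] := dm.
have co : coprime (2 * a) p.
  rewrite coprime_sym prime_coprime // Euclid_dvdM // negb_or pa.
  by rewrite -prime_coprime // coprime_sym coprime2n op.
(* Hensel lifting: replacing a by a + s' m adds 2 a s' m to a ^ 2 + b ^ 2 + 1 = t m,
   up to a multiple of m ^ 2, hence of p m. *)
have [s' pst] : exists s', p %| t + s' * (2 * a).
  have /dvdnP[s' sE] : 2 * a %| chinese (2 * a) p 0 (p.-1 * t).
    by rewrite /dvdn chinese_modl ?mod0n.
  exists s'; rewrite -sE /dvdn -modnDmr chinese_modr // modnDmr -mulSn prednK ?prime_gt0 //.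
  by rewrite modnMr.
exists (a + s' * m), b; rewrite nE.
have -> : (a + s' * m) ^ 2 + b ^ 2 + 1 = (t + s' * (2 * a) + s' ^ 2 * m) * m.
  rewrite !mulnDl -tE; ring.
by rewrite mulnC dvdn_pmul2r ?odd_gt0 // dvdn_add // dvdn_mull.
Qed.

(** - 7 is a square modulo every power of 2: if t is odd in x ^ 2 + 7 = 2 ^ e t,
    then x is replaced by x + 2 ^ (e - 1). *)
Lemma sqrt_neg7 e : exists x, odd x /\ 2 ^ e.+3 %| x ^ 2 + 7.
Proof.
elim: e => [|e [x [ox /dvdnP[t tE]]]]; first by exists 1.
have [et|ot] := boolP (odd t); last first.
  exists x; split=> //; rewrite tE expnS dvdn_pmul2r ?expn_gt0 //.
  by rewrite dvdn2.
exists (x + 2 ^ e.+2); split; first by rewrite oddD ox oddX.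
have -> : (x + 2 ^ e.+2) ^ 2 + 7 = (t + x + 2 ^ e.+1) * 2 ^ e.+3.
  rewrite !mulnDl -tE !expnS; ring.
by rewrite [2 ^ _]expnS dvdn_pmul2r ?expn_gt0 // dvdn2 !oddD et ox oddX.
Qed.

(** - 1 is a sum of four squares modulo any n: two squares suffice for the odd
    part of n, and - 1 = x ^ 2 + 2 ^ 2 + 1 + 1 for the power of 2. *)
Lemma sum4sq n : 0 < n -> exists a b c d, n %| a ^ 2 + b ^ 2 + c ^ 2 + d ^ 2 + 1.
Proof.
move=> n0; have [m om nE] : exists2 m, odd m & n = m * 2 ^ logn 2 n.
  exists (n`_2^')%N; last by rewrite mulnC -p_part partnC.
  by have := part_pnat 2^' n; rewrite p'natE // dvdn2 negbK.
have [a [b dm]] := sum2sq_odd om.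
have [x [_ dx]] := sqrt_neg7 (logn 2 n).
set e := logn 2 n in nE dx; set q := 2 ^ e in nE.
have co : coprime m q by rewrite coprimeXr // coprimen2.
exists (chinese m q a x), (chinese m q b 2), (chinese m q 0 1), (chinese m q 0 1).
rewrite nE Gauss_dvd //; apply/andP; split.
  by apply: (@sum4sq_congr m a b 0 0); rewrite ?chinese_modl // !addn0.
apply: (@sum4sq_congr q x 2 1 1); rewrite ?chinese_modr //.
rewrite -!addnA; apply: dvdn_trans dx; rewrite dvdn_exp2l //; lia.
Qed.

End FourSquares.

(** * Diagonal entries of the associativity isomorphisms *)

Lemma sum_only (V : nmodType) (I : finType) (i0 : I) (F : I -> V) :
  (forall i, i != i0 -> F i = 0) -> \sum_i F i = F i0.
Proof. by move=> F0; rewrite (bigD1 i0) //= big1 ?addr0. Qed.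

(** The trace of a map on a space of finite families, given by a matrix [M] in
    the standard basis, is the trace of [M]. *)
Lemma endo_trace_ffun (K : fieldType) (I : finType) (M : I -> I -> K)
    (E : {ffun I -> K^o} -> {ffun I -> K^o}) :
  (forall g q, E g q = \sum_p M p q * g p) ->
  endo_trace E = \sum_p M p p.
Proof.
move=> EM; rewrite /endo_trace.
set b := vbasis _; set d := fun p : I => [ffun q => M p q : K^o] : {ffun I -> K^o}.
have Eb (i : 'I_(\dim {: {ffun I -> K^o}})) :
    coord b i (E b`_i) = \sum_p (coord b i (d p) * b`_i p).
  have -> : E b`_i = \sum_p (b`_i p : K) *: d p.
    apply/ffunP => q; rewrite EM sum_ffunE; apply: eq_bigr => p _.
    by rewrite !ffunE [RHS]mulrC.
  rewrite linear_sum; apply: eq_bigr => p _.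
  by rewrite linearZ /= mulrC.
under eq_bigr do rewrite Eb.
rewrite exchange_big; apply: eq_bigr => p _ /=.
have /(congr1 (fun g : {ffun I -> K^o} => g p)) := coord_vbasis (memvf (d p)).
rewrite sum_ffunE ffunE => ->; apply: eq_bigr => i _.
by rewrite ffunE.
Qed.

Section Entries.

Variables (A : finGroupType) (K : numClosedFieldType).
Variables (chi : A -> A -> K) (tau : K).
Hypothesis abA : abelian [set: A].
Implicit Types X Y Z : fsum A.

(** Unlike the components of a morphism, its entries are defined at all pairs of
    indices, so that the composition is the full matrix product. *)
Lemma entry_neq X Y (f : fhom K X Y) i j : flab i != flab j -> entry f i j = 0.
Proof. by move=> ne; rewrite /entry insubN //=. Qed.

Lemma fhomE X Y (f : fhom K X Y) p : f p = entry f (val p).1 (val p).2.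
Proof. by rewrite /entry -surjective_pairing valK. Qed.

Lemma entry_eq X Y F (i : fidx X) (j : fidx Y) :
  (flab i != flab j -> F i j = 0) -> entry (@fmx _ K X Y F) i j = F i j.
Proof. by move=> F0; rewrite entry_fmx; case: ifPn => // /F0. Qed.

Lemma entry_fcomp X Y Z (g : fhom K Y Z) (f : fhom K X Y) i k :
  entry (fcomp g f) i k = \sum_j entry f i j * entry g j k.
Proof.
apply: entry_eq => ne; apply: big1 => j _.
have [e|/entry_neq-> //] := eqVneq (flab i) (flab j); last by rewrite mul0r.
by rewrite [entry g _ _]entry_neq ?mulr0 // -e.
Qed.

Lemma entry_fid X i j : entry (fid K X) i j = (i == j)%:R.
Proof. by apply: entry_eq; case: (i =P j) => [->|//]; rewrite eqxx. Qed.

Lemma entry_ftensm X X' Y Y' (f : fhom K X X') (g : fhom K Y Y')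
    (p : tidx X Y) (q : tidx X' Y') :
  entry (ftensm f g) p q = entry f (val p).1.1 (val q).1.1 *
    entry g (val p).1.2 (val q).1.2 * ((val p).2 == (val q).2)%:R.
Proof.
rewrite /ftensm entry_eq; first by move: p q => [[[i j] u] /= up] [[[i' j'] u'] /= uq].
by move: p q => [[[i j] u] /= up] [[[i' j'] u'] /= uq] /= /negPf->; rewrite mulr0.
Qed.

Lemma fcomp1f X Y (f : fhom K X Y) : fcomp (fid K Y) f = f.
Proof.
apply/ffunP => p; rewrite !fhomE entry_fcomp (@sum_only _ _ (val p).2).
  by rewrite entry_fid eqxx mulr1.
by move=> j ne; rewrite entry_fid (negPf ne) mulr0.
Qed.

Lemma in_tensC (s t u : option A) : in_tens s t u = in_tens t s u.
Proof.
case: s t => [a|] [b|] //=; congr (_ == Some _).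
by apply/(centsP abA); rewrite inE.
Qed.

(** The matrix of (id (x) F) o assoc for the simple object s. An entry of the
    composite is a sum of one term: the intermediate index is determined by the
    row index i of [p] and the label of q', the column index of F. *)
Lemma entry_tensm_assoc s Z Z' (F : fhom K (ftens Z (fsimple s)) Z')
    (p : tidx (ftens (fsimple s) Z) (fsimple s)) (q : tidx (fsimple s) Z')
    (p' : tidx Z (fsimple s)) i e u q' (r : tidx (fsimple s) Z) :
  val r = (tt, i, e) -> val p = (r, tt, u) -> val q = (tt, q', u) ->
  val p' = (i, tt, flab q') ->
  entry (fcomp (ftensm (fid K (fsimple s)) F)
               (fassoc chi tau (fsimple s) Z (fsimple s))) p q =
  Fsym chi tau s (flab i) s e (flab q') u * entry F p' q'.
Proof.
move=> rE pE qE p'E.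
have hj : in_tens (@flab _ (fsimple s) tt) (@flab _ (ftens Z (fsimple s)) p') u.
  by have := valP q; rewrite qE /= p'E.
pose j : tidx (fsimple s) (ftens Z (fsimple s)) := exist _ (tt, p', u) hj.
rewrite entry_fcomp (@sum_only _ _ j).
  rewrite [X in _ * X]entry_ftensm entry_fid qE /= !eqxx mul1r mulr1.
  rewrite entry_eq /= pE /= ?eqxx // rE p'E /=.
  by rewrite !eqxx mul1r.
move=> [[[[] [[[i2 []] f] h1]] v] h2] ne.
rewrite entry_ftensm /= qE /=.
have [fe|fe] := eqVneq f (flab q'); last first.
  by rewrite [X in _ * (_ * X * _)]entry_neq ?mulr0 ?mul0r ?mulr0.
have [vu|vu] := eqVneq v u; last by rewrite !mulr0.
rewrite [X in X * _]entry_eq /= pE /= vu eqxx // rE /= andbT.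
have [e1|] := eqVneq i i2; last by rewrite !mul0r.
case/eqP: ne; apply: val_inj => /=; rewrite vu; congr (_, _, _).
by apply: val_inj => /=; rewrite p'E e1 fe.
Qed.

(** The diagonal entry, at the summand u of Z_i (x) s, of a morphism F from
    Z (x) s to s (x) Z, where Z_i (x) s and s (x) Z_i are identified; 0 if u does
    not occur in Z_i (x) s. *)
Definition diag_entry s (Z : fsum A)
    (F : fhom K (ftens Z (fsimple s)) (ftens (fsimple s) Z)) (i : fidx Z) u : K :=
  if (insub (i, tt, u) : option (tidx Z (fsimple s)),
      insub (tt, i, u) : option (tidx (fsimple s) Z)) is (Some p, Some q)
  then entry F p q else 0.

Lemma diag_entryE s Z (F : fhom K (ftens Z (fsimple s)) (ftens (fsimple s) Z))
    i u (p : tidx Z (fsimple s)) (q : tidx (fsimple s) Z) :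
  val p = (i, tt, u) -> val q = (tt, i, u) -> diag_entry F i u = entry F p q.
Proof. by move=> pE qE; rewrite /diag_entry -pE -qE !valK. Qed.

(** The associativity isomorphism of a power of s is built by a recursion that
    preserves the diagonal: its diagonal entry at i = (i', e) involves only the
    diagonal entry of the previous one at i', e. *)
Lemma diag_entry_rec s Z (F : fhom K (ftens Z (fsimple s)) (ftens (fsimple s) Z))
    (i : tidx (fsimple s) Z) u i' e :
  val i = (tt, i', e) -> in_tens s e u ->
  @diag_entry s (ftens (fsimple s) Z)
    (fcomp (ftensm (fid K (fsimple s)) F)
           (fassoc chi tau (fsimple s) Z (fsimple s))) i u =
  Fsym chi tau s (flab i') s e e u * diag_entry F i' e.
Proof.
move=> iE h.
have hi : in_tens s (flab i') e by have := valP i; rewrite iE.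
have hp : in_tens (@flab _ (ftens (fsimple s) Z) i) (@flab _ (fsimple s) tt) u.
  by rewrite /= iE in_tensC.
have hq : in_tens (@flab _ (fsimple s) tt) (@flab _ (ftens (fsimple s) Z) i) u.
  by rewrite /= iE.
have hp' : in_tens (flab i') (@flab _ (fsimple s) tt) e by rewrite in_tensC.
rewrite (@diag_entryE s (ftens (fsimple s) Z) _ i u
  (exist _ (i, tt, u) hp) (exist _ (tt, i, u) hq)) //.
rewrite (@diag_entryE s Z F i' e (exist _ (i', tt, e) hp') i) //.
rewrite (@entry_tensm_assoc s Z _ F _ _ (exist _ (i', tt, e) hp') i' e u i i) //=.
  by rewrite iE.
by rewrite iE.
Qed.

Lemma diag_entry_fid s u : in_tens s s u ->
  @diag_entry s (fsimple s) (fid K (ftens (fsimple s) (fsimple s))) tt u = 1.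
Proof.
move=> h; pose p : tidx (fsimple s) (fsimple s) := exist _ (tt, tt, u) h.
rewrite (@diag_entryE s (fsimple s) _ tt u p p) //.
rewrite (@entry_fid (ftens (fsimple s) (fsimple s)) p p).
by rewrite eqxx.
Qed.

Section Powers.

Variable s : option A.
Local Notation C := (TY chi tau).
Local Notation V := (fsimple s : C).
Local Notation lab n i := (@flab A (tpow V n) i).

(** The diagonal entries of the isomorphism from the product of the power n + 1
    of s with s to the power n + 2. *)
Definition diag_assoc n (i : fidx (tpow V n.+1)) (u : option A) : K :=
  diag_entry (tpow_assoc V n.+1 : fhom K (ftens (tpow V n.+1) V) (tpow V n.+2)) i u.

Lemma diag_assoc0 u : in_tens s s u -> diag_assoc (tt : fidx (tpow V 1)) u = 1.
Proof. exact: diag_entry_fid. Qed.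

Lemma diag_assocS n (i : tidx (fsimple s) (tpow V n.+1)) u
    (i' : fidx (tpow V n.+1)) e :
  val i = (tt, i', e) -> in_tens s e u ->
  diag_assoc (i : fidx (tpow V n.+2)) u =
  Fsym chi tau s (lab n.+1 i') s e e u * diag_assoc i' e.
Proof.
move=> iE h.
(* The target of [tpow_assoc] is unfolded in two stages, for type checking to
   be fast. *)
pose F := (tpow_assoc V n.+1 : fhom K (ftens (tpow V n.+1) V) (tpow V n.+2))
  : fhom K (ftens (tpow V n.+1) (fsimple s)) (ftens (fsimple s) (tpow V n.+1)).
have rec_i := @diag_entry_rec s (tpow V n.+1) F i u i' e.
have {}rec_i := rec_i iE h.
exact rec_i.
Qed.

End Powers.
End Entries.

(** * The trace of the rotation operator *)

Section FS.

Variables (A : finGroupType) (K : numClosedFieldType).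
Variables (chi : A -> A -> K) (tau : K).
Hypothesis abA : abelian [set: A].
Hypotheses (chi11 : chi 1%g 1%g = 1) (tau0 : tau != 0).
Variable s : option A.
Local Notation C := (TY chi tau).
Local Notation V := (fsimple s).
Local Notation "1f" := (fone A).

Lemma in_tens_dual t : in_tens s t (Some 1%g) -> omap (fun a => a^-1%g) s = t.
Proof.
case: s t => [a|] [b|] //= /eqP[ab]; congr Some.
by apply: (mulgI a); rewrite mulgV.
Qed.

(** For a morphism f from the unit to V (x) Z, the duality isomorphism leaves the
    coefficients of f unchanged: for V = m the factor tau of the associator and
    the factor tau^-1 of the evaluation cancel. *)
Lemma entry_dualA Z (f : fhom K 1f (ftens V Z)) (p : tidx (fdual V) 1f) (i : fidx Z)
    (q : tidx V Z) :
  val p = (tt, tt, omap (fun a => a^-1%g) s) -> val q = (tt, i, Some 1%g) ->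
  entry (@dualA K C 1f V Z f) p i = entry f tt q.
Proof.
move=> pE qE; rewrite /dualA /=.
have si : omap (fun a => a^-1%g) s = flab i.
  by have := valP q; rewrite qE /= => /in_tens_dual.
set u := omap _ s in pE si.
have h1 : in_tens (@flab _ (fdual V) tt) (@flab _ (ftens V Z) q) u.
  rewrite /= qE /= /u; case: (s) => //= a; first by rewrite mulg1.
(* [j1], [j2] and [j3] are the indices through which the only nonzero term of
   each matrix product passes. *)
pose j1 : tidx (fdual V) (ftens V Z) := exist _ (tt, q, u) h1.
have h2 : in_tens (@flab _ (fdual V) tt) (@flab _ V tt) (Some 1%g).
  by rewrite /=; case: (s) => //= a; rewrite mulVg.
pose j2a : tidx (fdual V) V := exist _ (tt, tt, Some 1%g) h2.
have h2' : in_tens (@flab _ (ftens (fdual V) V) j2a) (flab i) u.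
  by rewrite /= si /=; case: (flab i) => //= a; rewrite mul1g.
pose j2 : tidx (ftens (fdual V) V) Z := exist _ (j2a, i, u) h2'.
have h3 : in_tens (@flab _ 1f tt) (flab i) u.
  by rewrite /= -si /=; case: (u) => //= a; rewrite mul1g.
pose j3 : tidx 1f Z := exist _ (tt, i, u) h3.
set c := if s is None then tau^-1 else 1.
have E1 j : entry (fcomp (flunit K Z) (ftensm (fev tau V) (fid K Z))) j i =
    ((val j).1.1 == j2a)%:R * c * ((val j).1.2 == i)%:R * ((val j).2 == u)%:R.
  rewrite entry_fcomp (@sum_only _ _ j3).
    rewrite entry_ftensm entry_fid [X in _ * X]entry_eq /=; last by rewrite si eqxx.
    rewrite eqxx mulr1.
    case: j => [[[[[[[] []] e] he] i2] v] h] /=.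
    rewrite entry_fmx /= mul1r.
    rewrite -[_ == j2a]val_eqE /= !xpair_eqE /=.
    by case: ifP => _; rewrite ?mul1r ?mul0r.
  move=> [[[[] i2] v] h] ne.
  rewrite [X in _ * X]entry_fmx /=; case: ifP => [/eqP vi|]; last by rewrite mulr0.
  have [e2|] := eqVneq i2 i; last by rewrite mulr0.
  by case/eqP: ne; apply: val_inj; rewrite /= vi e2 si.
have E2 j : entry (fcomp (fcomp (flunit K Z) (ftensm (fev tau V) (fid K Z)))
                        (fassocV chi tau (fdual V) V Z)) j i =
            entry (fassocV chi tau (fdual V) V Z) j j2 * c.
  rewrite entry_fcomp (@sum_only _ _ j2).
    by rewrite E1 /= !eqxx mul1r !mulr1.
  move=> [[[e i2] v] h] ne; rewrite E1 /=.
  have [h4|] := eqVneq e j2a; last by rewrite !mul0r mulr0.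
  have [h5|] := eqVneq i2 i; last by rewrite mulr0 mul0r mulr0.
  have [h6|] := eqVneq v u; last by rewrite mulr0 mulr0.
  by case/eqP: ne; apply: val_inj; rewrite /= h4 h5 h6.
rewrite entry_fcomp (@sum_only _ _ j1); last first.
  move=> [[[[] w] v] h] ne; rewrite entry_ftensm pE /=.
  have [vu|] := eqVneq u v; last by rewrite !mulr0 mul0r.
  rewrite E2 [X in _ * (X * _)]entry_eq /=; last by rewrite vu eqxx.
  have := erefl (val w).
  move: {-2}(val w) => [[[] i3] v3] wE; rewrite -wE /=.
  have [h4|] := eqVneq i i3; last by rewrite !mul0r ?mulr0.
  have [h5|] := eqVneq v3 (Some 1%g); last first.
    by move=> h6; rewrite [entry f _ _]entry_neq ?mulr0 ?mul0r //= -wE /= eq_sym.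
  case/eqP: ne; apply: val_inj; rewrite /= vu; congr (_, _, _).
  by apply: val_inj; rewrite qE -wE h4 h5.
rewrite E2 entry_ftensm pE /= entry_fid eqxx mul1r eqxx mulr1.
rewrite -[RHS]mulr1; congr (_ * _).
rewrite entry_eq /= qE /= !eqxx // mul1r -si /c /u.
case: (s) => [a|] /=; rewrite ?mulr1 //.
by rewrite chi11 mulr1 mulfV.
Qed.

(** The second duality isomorphism, on morphisms from V*, leaves the coefficients
    unchanged too, since the associator that it involves is an identity. *)
Lemma entry_dualB Z (g : fhom K (ftens 1f (fdual V)) Z)
    (p : tidx 1f (fdual V)) (q : tidx Z (fdual (fdual V))) i :
  val p = (tt, tt, omap (fun a => a^-1%g) s) -> val q = (i, tt, Some 1%g) ->
  entry (@dualB K C 1f (fdual V) Z g) tt q = entry g p i.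
Proof.
move=> pE qE; rewrite /dualB /=.
set u := omap _ s in pE.
have h1 : in_tens (@flab _ 1f tt) (@flab _ 1f tt) (Some 1%g) by rewrite /= mulg1.
(* [j1], [j2] and [j3] are the indices through which the only nonzero term of
   each matrix product passes. *)
pose j1 : tidx 1f 1f := exist _ (tt, tt, Some 1%g) h1.
have h2' : in_tens (@flab _ (fdual V) tt) (@flab _ (fdual (fdual V)) tt) (Some 1%g).
  by rewrite /=; case: (s) => //= a; rewrite mulgV.
pose j2a : tidx (fdual V) (fdual (fdual V)) := exist _ (tt, tt, Some 1%g) h2'.
pose j2 : tidx 1f (ftens (fdual V) (fdual (fdual V))) := exist _ (tt, j2a, Some 1%g) h1.
have h3 : in_tens (@flab _ (ftens 1f (fdual V)) p) (@flab _ (fdual (fdual V)) tt) (Some 1%g).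
  by rewrite /= pE /= /u; case: (s) => //= a; rewrite mulgV.
pose j3 : tidx (ftens 1f (fdual V)) (fdual (fdual V)) := exist _ (p, tt, Some 1%g) h3.
rewrite entry_fcomp (@sum_only _ _ j1); last first.
  move=> [[[[] []] v] h] ne.
  have [h4|] := eqVneq v (Some 1%g); last first.
    by move=> h6; rewrite entry_neq ?mul0r //= eq_sym.
  by case/eqP: ne; apply: val_inj; rewrite /= h4.
rewrite [X in X * _]entry_fmx /= eqxx mul1r.
rewrite entry_fcomp (@sum_only _ _ j2); last first.
  move=> [[[[] w] v] h] ne; rewrite [X in X * _]entry_ftensm /=.
  have [h4|] := eqVneq (Some 1%g) v; last by rewrite !mulr0 mul0r.
  case: w h ne => [[[[] []] e] he] h ne.
  have [h5|] := eqVneq e (Some 1%g); last first.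
    by move=> h6; rewrite [entry (fcoev _ _) _ _]entry_neq ?mulr0 ?mul0r //= eq_sym.
  case/eqP: ne; apply: val_inj; rewrite /= -h4; congr (_, _, _).
  by apply: val_inj; rewrite /= h5.
rewrite [X in X * _]entry_ftensm /= entry_fid entry_fmx /= !eqxx !mul1r.
rewrite entry_fcomp (@sum_only _ _ j3); last first.
  move=> [[[[[[[] []] e] he] []] v] h] ne.
  rewrite [X in X * _]entry_eq /=; last by rewrite eq_sym => /negPf->; rewrite mul0r.
  have [h4|] := eqVneq v (Some 1%g); last by rewrite !mul0r.
  case/eqP: ne; apply: val_inj; rewrite /= h4; congr (_, _, _).
  apply: val_inj; rewrite pE /=; congr (_, _, _).
  by move: {h} (he); rewrite /= /u; case: (s) (e) => [a|] [b|] //=; rewrite mul1g => /eqP.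
rewrite [X in X * _]entry_eq /= ?eqxx // pE /= ?eqxx ?mul1r.
rewrite entry_ftensm /= qE /= entry_fid !eqxx !mulr1.
rewrite -[RHS]mul1r; congr (_ * _).
by case: (s).
Qed.

(** A sum over the fibres of v at the values of h, outside of which F vanishes. *)
Lemma sum_fibre (R : nmodType) (I T J : finType) (v : I -> T) (h : J -> T) (F : I -> R) :
  injective h -> (forall i, (forall j, v i != h j) -> F i = 0) ->
  \sum_i F i = \sum_j \sum_(i | v i == h j) F i.
Proof.
move=> hI F0; rewrite (exchange_big_dep predT) //=; apply: eq_bigr => i _.
case: (pickP (fun j => v i == h j)) => [j /eqP vj|N].
  rewrite (big_pred1 j) // => j'; rewrite vj.
  by apply/eqP/eqP => [/hI->|->].
by rewrite big_pred0 // F0 // => j; rewrite N.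
Qed.

(** The trace of the rotation operator of V (x) Z, for a morphism Phi in the
    role of the associativity isomorphism: up to the coefficient of the pivotal
    structure, it is the sum of the diagonal entries of Phi at the summands 1. *)
Lemma trace_rotation Z (Phi : fhom K (ftens Z V) (ftens V Z)) :
  endo_trace (fun f : fhom K 1f (ftens V Z) =>
    fcomp (fcomp Phi (ftensm (fid K Z) (fpivV tau V)))
      (@dualB K C 1f (fdual V) Z
         (fcomp (fcomp (@dualA K C 1f V Z (fcomp (fid K (ftens V Z)) f))
                       (frunitV K (fdual V))) (flunit K (fdual V))))) =
  (if s is None then (Num.sg tau)^-1 else 1) *
  \sum_(i | in_tens s (flab i) (Some 1%g)) diag_entry Phi i (Some 1%g).
Proof.
have ss : omap (fun a => a^-1%g) (omap (fun a => a^-1%g) s) = s.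
  by case: (s) => //= a; rewrite invgK.
set c := if s is None then _ else _.
set Y := ftens V Z.
have E1 (w : tidx Z (fdual (fdual V))) (w' : tidx Z V) q :
    val w = val w' ->
    entry (fcomp Phi (ftensm (fid K Z) (fpivV tau V))) w q = c * entry Phi w' q.
  move=> ww; rewrite entry_fcomp (@sum_only _ _ w').
    rewrite entry_ftensm ww entry_fid !eqxx mulr1 mul1r; congr (_ * _).
    rewrite entry_eq; last by rewrite /= ss eqxx.
    by rewrite eqxx mul1r.
  move=> [[[i []] u] h] ne; rewrite [X in X * _]entry_ftensm ww entry_fid /=.
  have [h4|] := eqVneq (val w').1.1 i; last by rewrite !mul0r.
  have [h5|] := eqVneq (val w').2 u; last by rewrite mulr0 mul0r.
  case/eqP: ne; apply: val_inj; rewrite /= -h4 -h5.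
  by case: (w') => [[[? []] ?] ?].
(* Both index types that occur, that of Hom (1, V (x) Z) and the summands 1 of
   Z (x) V**, are reindexed by the i such that V (x) Z_i contains 1. *)
pose P : finType := {p : fidx 1f * fidx Y | flab p.1 == flab p.2}.
pose v (p : P) : unit * fidx Z * option A := val ((val p).2 : tidx V Z).
pose M (p q : P) : K := c *
  if insub ((v p).1.2, tt, Some 1%g) is Some w then entry Phi w (val q).2 else 0.
pose h i : unit * fidx Z * option A := (tt, i, Some 1%g).
have hI : injective h by move=> i i' [].
have vP (p : P) i : v p = h i -> in_tens s (flab i) (Some 1%g).
  move=> pE; have := valP ((val p).2 : tidx V Z).
  by rewrite -[val _]/(v p) pE.
have vI : injective v.
  move=> [[[] p] hp] [[[] q] hq]; rewrite /v /= => /val_inj pq.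
  by apply: val_inj; rewrite /= pq.
have exP i : in_tens s (flab i) (Some 1%g) -> exists p : P, v p = h i.
  move=> si; pose q : tidx V Z := exist _ (h i) si.
  have hq : flab (tt : fidx 1f) == flab (q : fidx Y) by [].
  by exists (exist _ (tt, q) hq).
have sumP (F : P -> K) : \sum_p F p = \sum_i \sum_(p | v p == h i) F p.
  apply: sum_fibre => // p N; case/eqP: (N (v p).1.2).
  have /eqP : Some 1%g == (v p).2 := valP p.
  by case: (v p) => [[[] i] u] /= <-.
rewrite (@endo_trace_ffun _ _ M).
  rewrite sumP mulr_sumr [RHS]big_mkcond; apply: eq_bigr => i _ /=.
  case: ifPn => [/[dup] si /exP[p pE]|si].
    rewrite (big_pred1 p) => [|p'] /=; last by rewrite -pE (inj_eq vI).
    rewrite /M pE /=; case: insubP => [w _ wE|/negP[]/=]; last by rewrite in_tensC.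
    congr (_ * _); apply: esym; apply: (@diag_entryE A K s Z Phi i _ w (val p).2) => //.
  rewrite big_pred0 // => p; apply: contraNF si => /eqP; exact: vP.
move=> g q; rewrite sumP fhomE.
have -> : (val q).1 = tt by case: (val q).1.
rewrite [LHS]entry_fcomp.
rewrite (@sum_fibre _ _ _ _ val (fun i => (i, tt, Some 1%g))) //; first last.
- move=> [[[i []] u] hw] N; rewrite [X in X * _]entry_neq ?mul0r //=.
  by have := N i; rewrite -[val _]/(i, tt, u) !xpair_eqE !eqxx eq_sym.
- by move=> i i' [].
apply: eq_bigr => i _.
have [/[dup] si /exP[p pE]|si] := boolP (in_tens s (flab i) (Some 1%g)); last first.
  rewrite !big_pred0 // => [p|w].
    by apply: contraNF si => /eqP; apply: vP.
  apply: contraNF si => /eqP wE; have := valP w.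
  by rewrite wE /= ss in_tensC.
have hw : in_tens (flab i) (@flab _ (fdual (fdual V)) tt) (Some 1%g).
  by rewrite /= ss in_tensC.
have hw' : in_tens (flab i) (@flab _ V tt) (Some 1%g) by rewrite /= in_tensC.
pose w : tidx Z (fdual (fdual V)) := exist _ (i, tt, Some 1%g) hw.
pose w' : tidx Z V := exist _ (i, tt, Some 1%g) hw'.
rewrite [LHS](big_pred1 w) => [|w2]; last exact: (val_eqE w2 w).
rewrite [RHS](big_pred1 p) => [|p2]; last by rewrite -pE (inj_eq vI).
have -> : M p q = c * entry Phi w' (val q).2.
  rewrite /M pE /=; case: insubP => [w2 _ w2E|/negP[]//].
  by congr (_ * entry _ _ _); apply: val_inj.
have h1 : in_tens (@flab _ 1f tt) (@flab _ (fdual V) tt) (omap (fun a => a^-1%g) s).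
  by rewrite /=; case: (s) => //= a; rewrite mul1g.
pose d : tidx 1f (fdual V) := exist _ (tt, tt, omap (fun a => a^-1%g) s) h1.
have h2 : in_tens (@flab _ (fdual V) tt) (@flab _ 1f tt) (omap (fun a => a^-1%g) s).
  by rewrite /=; case: (s) => //= a; rewrite mulg1.
pose d' : tidx (fdual V) 1f := exist _ (tt, tt, omap (fun a => a^-1%g) s) h2.
rewrite (@E1 w w') // [X in X * _](@entry_dualB Z _ d w i) //.
rewrite [LHS]mulrC; congr (_ * _).
rewrite entry_fcomp (@sum_only _ _ tt); last by case.
rewrite [X in X * _]entry_fmx /= eqxx mul1r.
rewrite entry_fcomp (@sum_only _ _ d'); last first.
  move=> [[[[] []] u] hu] ne; rewrite entry_neq ?mul0r //=.
  by apply: contra_neq ne => /= uE; apply: val_inj; rewrite /= uE.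
rewrite [X in X * _]entry_fmx /= eqxx mul1r.
rewrite (@entry_dualA Z _ d' i (val p).2) // fcomp1f fhomE.
by have -> : (val p).1 = tt by case: (val p).1.
Qed.

(** An indicator is a sum of diagonal entries of the associativity isomorphism. *)
Lemma FS_ind_diag n :
  FS_ind n.+2 (V : C) =
  (if s is None then (Num.sg tau)^-1 else 1) *
  \sum_(i : fidx (tpow (V : C) n.+1) | in_tens s (flab i) (Some 1%g))
     diag_assoc i (Some 1%g).
Proof.
pose Phi := (tpow_assoc (V : C) n.+1
    : fhom K (ftens (tpow (V : C) n.+1) V) (tpow (V : C) n.+2))
  : fhom K (ftens (tpow (V : C) n.+1) V) (ftens V (tpow (V : C) n.+1)).
exact (trace_rotation Phi).
Qed.

End FS.

(** * Indicators of the simple objects *)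

(** The sum over the paths y = x_0, x_1, ..., x_n in B of the product of the
    chi (x_i, x_(i-1)) / chi (x_i, x_i). At y = 1, for a symmetric bicharacter of
    a group, it is the Gauss sum of the inverse of the quadratic form
    sum x_i ^ 2 - sum x_i x_(i+1) on B ^ n, of type A_n. *)
Fixpoint path_sum (B : finType) (K : fieldType) (chi : B -> B -> K) n (y : B) : K :=
  if n is n'.+1 then \sum_x chi x y * (chi x x)^-1 * path_sum chi n' x else 1.

Section Ind.

Variables (A : finGroupType) (K : numClosedFieldType).
Variables (chi : A -> A -> K) (tau : K).
Hypothesis abA : abelian [set: A].
Hypotheses (chi11 : chi 1%g 1%g = 1) (tau0 : tau != 0).
Local Notation C := (TY chi tau).

(** A summand e of the power n + 2 of s comes from a summand i of the power n + 1
    such that e occurs in s (x) i. *)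
Lemma diag_sum_rec (s : option A) n e u : in_tens s e u ->
  \sum_(i : fidx (tpow (fsimple s : C) n.+2) | flab i == e) diag_assoc i u =
  \sum_(i : fidx (tpow (fsimple s : C) n.+1) | in_tens s (flab i) e)
     Fsym chi tau s (flab i) s e e u * diag_assoc i e.
Proof.
move=> h; set Z := tpow (fsimple s : C) n.+1.
rewrite (partition_big (fun i : tidx (fsimple s) Z => (val i).1.2)
           (fun i' : fidx Z => in_tens s (flab i') e)); last first.
  by move=> i /eqP <-; exact: valP i.
apply: eq_bigr => i' hi'.
pose j : tidx (fsimple s) Z := exist _ (tt, i', e) hi'.
rewrite (big_pred1 j).
  exact: (@diag_assocS A K chi tau abA s n j u i' e).
by move=> [[[[] i] e'] hi]; rewrite -[RHS](val_eqE _ j) /= !xpair_eqE /= andbC.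
Qed.

Lemma sum_label (I : finType) (lab : I -> option A) (F : I -> K) :
  \sum_(i | in_tens None (lab i) None) F i = \sum_x \sum_(i | lab i == Some x) F i.
Proof.
rewrite (exchange_big_dep (fun i => in_tens None (lab i) None)) /=; last first.
  by move=> x i _ /eqP->.
apply: eq_bigr => i; case: (lab i) => //= a _.
by rewrite (big_pred1 a) // => x; rewrite (inj_eq Some_inj) eq_sym.
Qed.

Lemma in_tens_None (t : option A) x : in_tens None t (Some x) = (t == None).
Proof. by case: t. Qed.

Lemma sum_label_factor (I : finType) (lab : I -> option A) (G : option A -> K)
    (F : I -> K) t :
  \sum_(i | lab i == t) G (lab i) * F i = G t * \sum_(i | lab i == t) F i.
Proof. by rewrite big_distrr; apply: eq_bigr => i /eqP->. Qed.

(** The sum of the diagonal entries, at u, over the summands e of the power n + 1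
    of m. *)
Definition diag_sum n (e u : option A) : K :=
  \sum_(i : fidx (tpow (fsimple None : C) n.+1) | flab i == e) diag_assoc i u.

Lemma diag_sum_even n x :
  diag_sum n.+1 (Some x) None = tau * (chi x x)^-1 * diag_sum n None (Some x).
Proof.
rewrite /diag_sum diag_sum_rec // (eq_bigl _ _ (fun i => in_tens_None (flab i) x)).
exact: (sum_label_factor _ (fun t => Fsym chi tau None t None (Some x) (Some x) None)).
Qed.

Lemma diag_sum_odd n y :
  diag_sum n.+1 None (Some y) = \sum_x chi x y * diag_sum n (Some x) None.
Proof.
rewrite /diag_sum diag_sum_rec // sum_label; apply: eq_bigr => x _.
exact: (sum_label_factor _ (fun t => Fsym chi tau None t None None None (Some y))).
Qed.

Lemma diag_sum_path j y : diag_sum j.*2 None (Some y) = tau ^+ j * path_sum chi j y.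
Proof.
elim: j y => [|j IHj] y.
  rewrite /diag_sum mul1r (big_pred1 tt); last by case; rewrite /= eqxx.
  exact: diag_assoc0.
rewrite doubleS diag_sum_odd exprS /= big_distrr; apply: eq_bigr => x _.
rewrite diag_sum_even IHj /=; ring.
Qed.

Lemma FS_ind_None k : FS_ind (2 * k.+1) (fsimple None : C) =
  (Num.sg tau)^-1 * tau ^+ k * path_sum chi k 1%g.
Proof.
rewrite mul2n doubleS FS_ind_diag // -mulrA; congr (_ * _).
rewrite -diag_sum_path; apply: eq_bigl => i; exact: in_tens_None.
Qed.

(** The powers of a group element a are simple, with label a ^ n. *)
Lemma tpow_group n a : exists i0 : fidx (tpow (fsimple (Some a) : C) n.+1),
  (forall i, i = i0) /\ flab i0 = Some (a ^+ n.+1)%g.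
Proof.
elim: n => [|n [i0 [i0u i0E]]]; first by exists tt; split=> // -[].
have h : in_tens (Some a) (flab i0) (Some (a ^+ n.+2)%g) by rewrite i0E /= expgS.
exists (exist _ (tt, i0, Some (a ^+ n.+2)%g) h); split=> //.
move=> [[[[] i] u] hi]; apply: val_inj; rewrite /= (i0u i); congr (_, _, _).
by move: hi; rewrite /= (i0u i) i0E -expgS => /eqP.
Qed.

Lemma diag_assoc_group n a (i : fidx (tpow (fsimple (Some a) : C) n.+1)) u :
  in_tens (Some a) (flab i) u -> diag_assoc i u = 1.
Proof.
elim: n i u => [|n IHn] i u h.
  by case: i h => h; exact: (@diag_assoc0 A K chi tau (Some a) u h).
case: i h => [[[[] i'] e] hi] h.
pose j : tidx (fsimple (Some a)) (tpow (fsimple (Some a) : C) n.+1) :=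
  exist _ (tt, i', e) hi.
have := @diag_assocS A K chi tau abA (Some a) n j u i' e (erefl _) h.
rewrite IHn // mulr1 => ->.
by have [i0 [i0u i0E]] := tpow_group n a; rewrite (i0u i') i0E.
Qed.

Lemma FS_ind_group n a : FS_ind n.+2 (fsimple (Some a) : C) = ((a ^+ n.+2)%g == 1%g)%:R.
Proof.
rewrite FS_ind_diag // mul1r.
have [i0 [i0u i0E]] := tpow_group n a.
rewrite big_mkcond (bigD1 i0) //= big1 ?addr0; last by move=> i; rewrite (i0u i) eqxx.
rewrite i0E (inj_eq Some_inj) -expgS eq_sym; case: eqP => // e.
by apply: diag_assoc_group; rewrite i0E /= -expgS e.
Qed.

End Ind.

Lemma sum_option (T : finType) (R : nmodType) (F : option T -> R) :
  \sum_s F s = F None + \sum_x F (Some x).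
Proof.
rewrite (bigD1 None) //= (reindex_omap Some (@id (option T))) //=; last by case.
by congr (_ + _); apply: eq_bigl => x; rewrite eqxx.
Qed.

(** The pivotal dimension sqrt #|A| of m and the sign of tau combine to tau^-1. *)
Lemma TY_indE (A : finGroupType) (K : numClosedFieldType) (chi : A -> A -> K) (tau : K) k :
  abelian [set: A] -> bicharacter chi -> tau ^+ 2 = #|A|%:R^-1 ->
  TY_ind chi tau (2 * k.+1) =
  #|('Ldiv_(2 * k.+1)() : {set A})%g|%:R + tau^-1 * tau ^+ k * path_sum chi k 1%g.
Proof.
move=> abA [n0 Ml Mr] tauE.
have chi11 : chi 1%g 1%g = 1 by apply: (mulfI (n0 1%g 1%g)); rewrite -Ml mul1g mulr1.
have N0 : #|A|%:R != 0 :> K by rewrite pnatr_eq0 -lt0n; apply/card_gt0P; exists 1%g.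
have tau0 : tau != 0.
  by apply: contraNneq (invr_neq0 N0) => t0; rewrite -tauE t0 expr0n.
rewrite /TY_ind sum_option addrC.
congr (_ + _).
  rewrite -sum1_card natr_sum [RHS]big_mkcond; apply: eq_bigr => a _.
  rewrite pdim_TY // mulr1 mulnS FS_ind_group // inE -mulnS.
  by rewrite [(2 * k.+1)%N]mulnS; case: ifP.
have sg0 : Num.sg tau != 0 by rewrite sgr_eq0.
rewrite pdim_TY // FS_ind_None // -(sg_tauV tauE).
by field; rewrite sg0 tau0.
Qed.

(** * Path sums of a bicharacter and their modulus *)

Section Bichar.

Variables (A : finGroupType) (K : numClosedFieldType) (chi : A -> A -> K).
Hypotheses (chiB : bicharacter chi) (chiS : symmetric_bichar chi).
Hypothesis chiN : nondegenerate_bichar chi.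
Local Notation N := #|A|.

Lemma bichar_neq0 a b : chi a b != 0. Proof. by case: chiB. Qed.
Lemma bicharMl a b c : chi (a * b)%g c = chi a c * chi b c. Proof. by case: chiB. Qed.
Lemma bicharMr a b c : chi a (b * c)%g = chi a b * chi a c. Proof. by case: chiB. Qed.

Lemma bichar1l b : chi 1%g b = 1.
Proof. by apply: (mulfI (bichar_neq0 1%g b)); rewrite -bicharMl mul1g mulr1. Qed.

Lemma bichar1r a : chi a 1%g = 1. Proof. by rewrite chiS bichar1l. Qed.

Lemma bicharXl a b n : chi (a ^+ n)%g b = chi a b ^+ n.
Proof. by elim: n => [|n IHn]; rewrite ?bichar1l // expgS exprS bicharMl IHn. Qed.

Lemma bicharXr a b n : chi a (b ^+ n)%g = chi a b ^+ n.
Proof. by rewrite chiS bicharXl chiS. Qed.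

Lemma bicharVl a b : chi a^-1%g b = (chi a b)^-1.
Proof.
apply: (mulfI (bichar_neq0 a b)).
by rewrite -bicharMl mulgV bichar1l divff ?bichar_neq0.
Qed.

Lemma bicharVr a b : chi a b^-1%g = (chi a b)^-1.
Proof. by rewrite chiS bicharVl chiS. Qed.

Lemma bichar_card a b : chi a b ^+ N = 1.
Proof. by rewrite -bicharXl -cardsT expg_cardG ?inE // bichar1l. Qed.

Lemma norm_bichar a b : `|chi a b| = 1.
Proof.
apply/eqP; rewrite -(@pexpr_eq1 _ _ N) //; last exact: cardA_gt0.
by rewrite -normrX bichar_card normr1.
Qed.

Lemma bichar_conj a b : (chi a b)^* = (chi a b)^-1.
Proof. by rewrite invC_norm norm_bichar expr1n invr1 mul1r. Qed.

Lemma natr_card_neq0 : N%:R != 0 :> K.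
Proof. by rewrite pnatr_eq0 -lt0n cardA_gt0. Qed.

Lemma bichar_plancherel (f : A -> K) :
  \sum_y `|\sum_x chi x y * f x| ^+ 2 = N%:R * \sum_x `|f x| ^+ 2.
Proof.
transitivity (\sum_y \sum_x \sum_z (f x * (f z)^*) * chi (x * z^-1)%g y).
  apply: eq_bigr => y _; rewrite normCK rmorph_sum big_distrl; apply: eq_bigr => x _.
  rewrite /= big_distrr; apply: eq_bigr => z _ /=.
  by rewrite rmorphM /= bichar_conj bicharMl bicharVl; ring.
rewrite exchange_big big_distrr; apply: eq_bigr => x _ /=.
rewrite exchange_big (bigD1 x) //= [X in _ + X]big1 ?addr0.
  by rewrite -big_distrr /= (bichar_sum chiB chiS chiN) mulgV eqxx mulr1 normCK mulrC.
move=> z zx; rewrite -big_distrr /= (bichar_sum chiB chiS chiN).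
by rewrite -eq_mulgV1 eq_sym (negPf zx) !mulr0.
Qed.

Lemma path_sum_norm j : \sum_y `|path_sum chi j y| ^+ 2 = N%:R ^+ j.+1.
Proof.
elim: j => [|j IHj] /=.
  by under eq_bigr do rewrite normr1 expr1n; rewrite sumr_const.
under eq_bigr do under eq_bigr do rewrite -mulrA.
rewrite bichar_plancherel exprS -IHj; congr (_ * _); apply: eq_bigr => x _.
by rewrite normrM normfV norm_bichar invr1 mul1r.
Qed.

(** Heisenberg covariance: one step of the path sum turns multiplication by
    chi (a, .) into translation by a, and translation by b into translation by
    b ^ 2 times multiplication by chi (b, .)^-1, up to a scalar. *)
Lemma path_sum_shift j a y :
  path_sum chi j (y * a ^+ j.+1)%g =
  chi a a ^+ 'C(j.+1, 2) * chi a y ^+ j * path_sum chi j y.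
Proof.
elim: j y => [|j IHj] y /=; first by rewrite bin_small // !mul1r.
rewrite (reindex_inj (mulIg (a ^+ j.+1)%g)) big_distrr; apply: eq_bigr => x _ /=.
rewrite IHj !(bicharMl, bicharMr, bicharXl, bicharXr) [chi x a]chiS [in RHS]binS bin1.
have := bichar_neq0 a a; have := bichar_neq0 a x; have := bichar_neq0 x x.
set u := chi a x; set v := chi a a; set w := chi a y.
move=> x0 u0 v0; rewrite [v ^+ j.+2]exprS !exprMn exprD.
have : (v ^+ j.+1) ^+ j.+1 != 0 by rewrite !expf_neq0.
have : u ^+ j != 0 by rewrite expf_neq0.
set q := (v ^+ j.+1) ^+ j.+1; set c := v ^+ 'C(_, _); set r := u ^+ j.
move=> r0 q0; rewrite ![u ^+ _.+1]exprS -/r; field.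
by rewrite q0 r0 u0 x0.
Qed.

(** If a ^ (j + 1) = 1 then the translation above is trivial. *)
Lemma path_sum_fixed j a y : (a ^+ j.+1 = 1)%g ->
  chi a a ^+ 'C(j.+1, 2) * path_sum chi j y = chi a y * path_sum chi j y.
Proof.
move=> a1; have c1 : chi a y ^+ j.+1 = 1 by rewrite -bicharXl a1 bichar1l.
have := path_sum_shift j a y; rewrite a1 mulg1 => {2}->.
rewrite -[LHS]mul1r -c1 exprS; ring.
Qed.

Lemma path_sum1_eq0 j a : (a ^+ j.+1 = 1)%g -> chi a a ^+ 'C(j.+1, 2) != 1 ->
  path_sum chi j 1%g = 0.
Proof.
move=> a1 c1; have /eqP := path_sum_fixed 1%g a1.
by rewrite bichar1r -subr_eq0 -mulrBl mulf_eq0 subr_eq0 (negPf c1) => /eqP.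
Qed.

(** By [path_sum_shift] the path sum has constant modulus on the powers
    a ^ (j + 1); by [path_sum_fixed] it vanishes outside of the orthogonal of the
    (j + 1)-torsion, which is the set of these powers. The value at 1 then follows
    from [path_sum_norm]. *)
Lemma path_sum1_norm j :
  (forall a, (a ^+ j.+1 = 1)%g -> chi a a ^+ 'C(j.+1, 2) = 1) ->
  `|path_sum chi j 1%g| ^+ 2 = #|('Ldiv_(j.+1)() : {set A})%g|%:R * N%:R ^+ j.
Proof.
move=> triv; have N0 := natr_card_neq0.
apply: (mulfI N0); apply: (mulfI N0).
transitivity (N%:R * \sum_a `|path_sum chi j (a ^+ j.+1)%g| ^+ 2).
  congr (_ * _); transitivity (\sum_(a : A) `|path_sum chi j 1%g| ^+ 2).
    by rewrite sumr_const mulr_natl.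
  apply: eq_bigr => a _; have := path_sum_shift j a 1%g; rewrite mul1g => ->.
  by rewrite !normrM !normrX !norm_bichar !expr1n !mul1r.
transitivity (\sum_a \sum_y `|path_sum chi j y| ^+ 2 * \sum_b chi (a ^+ j.+1 * y^-1)%g b).
  rewrite big_distrr; apply: eq_bigr => a _ /=.
  rewrite (bigD1 (a ^+ j.+1)%g) //= [X in _ + X]big1 ?addr0.
    by rewrite (bichar_sum chiB chiS chiN) mulgV eqxx mulr1 mulrC.
  move=> y ya; rewrite (bichar_sum chiB chiS chiN) -eq_mulgV1 eq_sym (negPf ya).
  by rewrite !mulr0.
(* The orthogonality relation has replaced the condition y = a ^ (j + 1) by a
   sum over b; the sum over a now selects the b such that b ^ (j + 1) = 1. *)
transitivity (\sum_y \sum_b `|path_sum chi j y| ^+ 2 * (chi b y)^-1 * \sum_a chi (b ^+ j.+1)%g a).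
  rewrite exchange_big; apply: eq_bigr => y _ /=.
  under eq_bigr do rewrite big_distrr /=.
  rewrite exchange_big; apply: eq_bigr => b _ /=.
  rewrite big_distrr; apply: eq_bigr => a _ /=.
  by rewrite bicharMl bicharVl !bicharXl [chi y b]chiS [chi a b]chiS; ring.
transitivity (\sum_y N%:R * #|('Ldiv_(j.+1)() : {set A})%g|%:R * `|path_sum chi j y| ^+ 2).
  apply: eq_bigr => y _; rewrite -[#|_|]sum1_card natr_sum big_distrr big_distrl /=.
  rewrite [RHS]big_mkcond; apply: eq_bigr => b _; rewrite (bichar_sum chiB chiS chiN) inE.
  case: eqP => [b1|]; last by rewrite !mulr0.
  rewrite !mulr1 mulrC -mulrA; congr (_ * _).
  have /eqP := path_sum_fixed y b1; rewrite triv // mul1r -subr_eq0.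
  rewrite -{1}[path_sum _ _ _]mul1r -mulrBl mulf_eq0.
  case/orP; first by rewrite subr_eq0 => /eqP<-; rewrite invr1 mulr1.
  by move/eqP->; rewrite normr0 expr0n mul0r.
by rewrite -big_distrr path_sum_norm exprS /=; ring.
Qed.

End Bichar.

(** * The fourth power of a path sum *)

(** Path sums are multiplicative for orthogonal sums of bilinear forms. *)
Lemma path_sum_prod (I B : finType) (K : fieldType) (chi : B -> B -> K) n (f : {ffun I -> B}) :
  path_sum (fun f g : {ffun I -> B} => \prod_i chi (f i) (g i)) n f =
  \prod_i path_sum chi n (f i).
Proof.
elim: n f => [|n IHn] f /=; first by rewrite big1.
rewrite bigA_distr_bigA; apply: eq_bigr => g _ /=.
by rewrite IHn -prodfV -!big_split.
Qed.

(** Path sums are invariant under isometries. *)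
Lemma path_sum_iso (B : finType) (K : fieldType) (chi chi' : B -> B -> K) (phi : B -> B) n y :
  injective phi -> (forall x z, chi' (phi x) (phi z) = chi x z) ->
  path_sum chi' n (phi y) = path_sum chi n y.
Proof.
move=> phiI H; elim: n y => [|n IHn] y //=.
by rewrite (reindex_inj phiI); apply: eq_bigr => x _ /=; rewrite !H IHn.
Qed.

Lemma exprz_sum (K : fieldType) (x : K) (I : finType) (F : I -> int) :
  x != 0 -> x ^ (\sum_i F i) = \prod_i x ^ F i.
Proof.
move=> x0; apply: (big_morph (fun m => x ^ m)) => [m n|]; last by rewrite expr0z.
exact: expfzDr.
Qed.

(** The matrix of the multiplication by the quaternion a + b i + c j + d k, up to
    signs and order of the basis: a similitude of the sum of four squares. *)
Definition quat (a b c d : int) : 'M[int]_4 :=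
  \matrix_(i, j) nth 0 (nth [::] [:: [:: a; b; c; d]; [:: - b; a; - d; c];
                                     [:: - c; d; a; - b]; [:: - d; - c; b; a]] i) j.

Lemma quat_orth a b c d :
  (quat a b c d)^T *m quat a b c d = (a ^+ 2 + b ^+ 2 + c ^+ 2 + d ^+ 2)%:M.
Proof.
apply/matrixP => i j; rewrite !mxE !big_ord_recr big_ord0 /= !mxE /=.
move: i j => [[|[|[|[|//]]]] hi] [[|[|[|[|//]]]] hj] /=; ring.
Qed.

Section Quartic.

Variables (A : finGroupType) (K : numClosedFieldType) (chi : A -> A -> K).
Hypotheses (chiB : bicharacter chi) (chiS : symmetric_bichar chi).
Hypothesis chiN : nondegenerate_bichar chi.

Lemma bichar_prodl (I : finType) (F : I -> A) b :
  chi (\prod_i F i)%g b = \prod_i chi (F i) b.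
Proof. by apply: (big_morph (chi^~ b)); [move=> x y; rewrite bicharMl | rewrite bichar1l]. Qed.

(** Integer exponents are reduced mod #|A|, since only natural powers are
    available in A. *)
Lemma bichar_expz a b (m : int) : chi (a ^+ `|(m %% #|A|)%Z|)%g b = chi a b ^ m.
Proof.
rewrite bicharXl // [in RHS](divz_eq m #|A|) expfzDr ?bichar_neq0 //.
rewrite [(m %/ _)%Z * _]mulrC -exprz_exp -exprnP bichar_card // exp1rz mul1r.
by rewrite -[in RHS](gez0_abs (modz_ge0 m _)) // eqz_nat -lt0n cardA_gt0.
Qed.

(** A quaternion acts on A ^ 4, with the orthogonal sum of four copies of chi, as
    a similitude whose ratio is its norm. *)
Lemma bichar_quat a b c d (x y : {ffun 'I_4 -> A}) :
  let M := quat a b c d in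
  let phi (x : {ffun 'I_4 -> A}) :=
    [ffun i => \prod_j (x j ^+ `|(M i j %% #|A|)%Z|%N)%g]%g : {ffun 'I_4 -> A} in
  \prod_i chi (phi x i) (phi y i) =
  \prod_i chi (x i) (y i) ^ (a ^+ 2 + b ^+ 2 + c ^+ 2 + d ^+ 2).
Proof.
move=> M phi.
transitivity (\prod_i \prod_j \prod_l chi (x j) (y l) ^ (M i j * M i l)).
  apply: eq_bigr => i _; rewrite !ffunE bichar_prodl; apply: eq_bigr => j _.
  rewrite chiS bichar_prodl; apply: eq_bigr => l _.
  by rewrite bichar_expz chiS bichar_expz exprz_exp.
rewrite exchange_big; apply: eq_bigr => j _ /=; rewrite exchange_big /=.
transitivity (\prod_l chi (x j) (y l) ^ ((M^T *m M) j l)).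
  apply: eq_bigr => l _; rewrite mxE exprz_sum ?bichar_neq0 //.
  by apply: eq_bigr => i _; rewrite [M^T j i]mxE.
rewrite quat_orth (bigD1 j) //= big1 ?mulr1 => [|l lj]; first by rewrite mxE eqxx mulr1n.
by rewrite mxE eq_sym (negPf lj) mulr0n expr0z.
Qed.

Lemma path_sum_conj n y : path_sum (fun x y => (chi x y)^-1) n y = (path_sum chi n y)^*.
Proof.
elim: n y => [|n IHn] y /=; first by rewrite rmorph1.
rewrite rmorph_sum; apply: eq_bigr => x _.
by rewrite !rmorphM fmorphV /= !bichar_conj // IHn.
Qed.

(** A quaternion of norm - 1 mod #|A| is an isometry from four copies of chi^-1
    to four copies of chi. *)
Lemma path_sum1_quartic n : path_sum chi n 1%g ^+ 4 = (path_sum chi n 1%g)^* ^+ 4.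
Proof.
have [a [b [c [d dN]]]] := sum4sq (cardA_gt0 A).
have ET u v : chi u v ^ (a%:Z ^+ 2 + b%:Z ^+ 2 + c%:Z ^+ 2 + d%:Z ^+ 2) = (chi u v)^-1.
  have -> : a%:Z ^+ 2 + b%:Z ^+ 2 + c%:Z ^+ 2 + d%:Z ^+ 2 = (a ^ 2 + b ^ 2 + c ^ 2 + d ^ 2)%N.
    by rewrite !PoszD -!mulnn !PoszM !expr2.
  apply: (mulfI (bichar_neq0 chiB u v)); rewrite divff ?bichar_neq0 //.
  rewrite -exprnP -exprS -addn1; case/dvdnP: dN => q ->.
  by rewrite mulnC exprM bichar_card // expr1n.
pose phi (x : {ffun 'I_4 -> A}) : {ffun 'I_4 -> A} :=
    [ffun i => \prod_j (x j ^+ `|(quat a b c d i j %% #|A|)%Z|%N)%g]%g.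
have phiE (x y : {ffun 'I_4 -> A}) :
  \prod_i chi (phi x i) (phi y i) = \prod_i (chi (x i) (y i))^-1.
  by rewrite bichar_quat; apply: eq_bigr => i _; rewrite ET.
have phiI : injective phi.
  move=> x y xy; apply/ffunP => i; apply/eqP; rewrite eq_mulgV1; apply/eqP.
  apply: chiN => z; pose w : {ffun 'I_4 -> A} := [ffun j => if j == i then z else 1%g].
  have prodw (u : {ffun 'I_4 -> A}) : \prod_j (chi (u j) (w j))^-1 = (chi z (u i))^-1.
    rewrite (bigD1 i) //= big1 ?mulr1 => [|j ji]; first by rewrite ffunE eqxx chiS.
    by rewrite ffunE (negPf ji) bichar1r // invr1.
  have /invr_inj e : (chi z (x i))^-1 = (chi z (y i))^-1.
    by rewrite -!prodw -!phiE xy.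
  by rewrite bicharMr // bicharVr // e divff ?bichar_neq0.
have phi1 : phi [ffun=> 1%g] = [ffun=> 1%g].
  by apply/ffunP => i; rewrite !ffunE big1 // => j _; rewrite ffunE expg1n.
have := @path_sum_iso _ K _ (fun f g : {ffun 'I_4 -> A} => \prod_i chi (f i) (g i))
  phi n [ffun=> 1%g] phiI phiE.
rewrite phi1 path_sum_prod (@path_sum_prod _ _ _ (fun x y => (chi x y)^-1)).
rewrite !big_ord_recr !big_ord0 /= !ffunE !path_sum_conj !mul1r => e.
by rewrite !exprSr !expr0 !mul1r.
Qed.

End Quartic.

(** * Integrality in odd order *)

Section Integral.

Variable K : numClosedFieldType.
Local Notation Zint := (integralOver (intmul (1 : K))).

(** 1 / 2 is not an algebraic integer. *)
Lemma odd_neq_double m (t : K) : Zint t -> (2 * m + 1)%:R != 2 * t.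
Proof.
move=> tZ; apply/eqP => mt.
have [p pm /rootP] : Zint (2^-1 : K).
  have -> : 2^-1 = t - m%:R :> K.
    have n2 : 2 != 0 :> K by rewrite pnatr_eq0.
    by apply: (mulfI n2); rewrite divff // mulrBr -mt natrD natrM addrC addKr.
  by apply: integral_sub tZ _; apply: integral_nat.
rewrite horner_coef size_map_inj_poly ?rmorph0 //; last exact: intr_inj.
have [d pd] : exists d, size p = d.+1.
  by exists (size p).-1; rewrite prednK // lt0n size_poly_eq0 monic_neq0.
(* The equation of 1 / 2, of degree d, is multiplied by 2 ^ d. *)
rewrite pd => /(congr1 (fun z => 2 ^+ d * z)).
rewrite mulr0 big_distrr /= big_ord_recr /= coef_map /=.
have -> : p`_d = 1 by move/monicP: pm; rewrite lead_coefE pd.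
rewrite mul1r -exprMn divff ?pnatr_eq0 // expr1n.
have -> : \sum_(i < d) 2 ^+ d * ((map_poly intr p)`_i * 2^-1 ^+ i) =
   (2 * \sum_(i < d) 2 ^+ (d - i.+1) * p`_i)%:~R :> K.
  rewrite big_distrr rmorph_sum /=; apply: eq_bigr => i _.
  rewrite !rmorphM rmorphXn rmorph_nat /= coef_map /= !mulrA -exprS -subSn // subSS.
  have -> : 2 ^+ d = 2 ^+ i * 2 ^+ (d - i) :> K by rewrite -exprD subnKC // ltnW.
  by rewrite exprVn; field; rewrite expf_neq0 // pnatr_eq0.
move/eqP; rewrite -(rmorphD intr _ 1) intr_eq0; lia.
Qed.

(** A number s congruent to 1 mod 2 satisfies s ^ 4 = 1 mod 8 and s ^ 2 = 1 mod 4,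
    which determines s ^ 4 among the numbers P ^ 2 and - P ^ 2, and then s ^ 2 among
    P and - P. *)
Lemma odd_sqr (s t : K) (P : nat) :
  Zint t -> s = 1 + 2 * t -> odd P -> s ^+ 8 = P%:R ^+ 4 ->
  s ^+ 2 = if (P == 1 %[mod 4])%N then P%:R else - P%:R.
Proof.
move=> tZ sE oP s8.
have nZ n : Zint n%:R by exact: integral_nat.
have PE : P%:R = 2 * (P./2)%:R + 1 :> K.
  by rewrite -natrM -(natrD _ _ 1) mul2n -[in LHS](odd_double_half P) oP addnC.
have s4 : s ^+ 4 = P%:R ^+ 2.
  have : (s ^+ 4) ^+ 2 = (P%:R ^+ 2) ^+ 2 by rewrite -!exprM.
  move/eqP; rewrite eqf_sqr => /orP[/eqP //|/eqP s4].
  (* Otherwise (P ^ 2 + 1) / 2 = (1 - s ^ 4) / 2 is odd, and twice an algebraic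
     integer. *)
  have /(odd_neq_double (P./2 ^ 2 + P./2)) :
      Zint (- (2 * (t + 3 * t ^+ 2 + 4 * t ^+ 3 + 2 * t ^+ 4))).
    by do ?[exact: tZ | exact: nZ | apply: integral_opp | apply: integral_add
           | apply: integral_mul].
  case/eqP; apply: (mulfI (_ : 2 != 0)); first by rewrite pnatr_eq0.
  transitivity (1 - s ^+ 4); last by rewrite sE; ring.
  rewrite s4 natrD natrM natrD natrX PE; ring.
have : (s ^+ 2) ^+ 2 = P%:R ^+ 2 by rewrite -exprM.
have uZ : Zint (t + t ^+ 2).
  by do ?[exact: tZ | apply: integral_add | apply: integral_mul].
have s2 : s ^+ 2 = 1 + 4 * (t + t ^+ 2) by rewrite sE; ring.
move/eqP; rewrite eqf_sqr => /orP[]/eqP sP; case: ifPn => // P4.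
  have /eqP[] := odd_neq_double P./2./2 uZ.
  apply: (mulfI (_ : 2 != 0)); first by rewrite pnatr_eq0.
  transitivity (P%:R - 1 : K); last by rewrite -sP s2; ring.
  by rewrite -natrM -(natrB _ (odd_gt0 oP)); congr _%:R; lia.
have /integral_opp/(odd_neq_double P./2./2)/eqP[] := uZ.
apply: (mulfI (_ : 2 != 0)); first by rewrite pnatr_eq0.
transitivity (P%:R + 1 : K).
  by rewrite -natrM -(natrD _ _ 1); congr _%:R; lia.
by rewrite -[P%:R]opprK -sP s2; ring.
Qed.


End Integral.

Section IntegralPath.

Variables (A : finGroupType) (K : numClosedFieldType) (chi : A -> A -> K).
Local Notation Zint := (integralOver (intmul (1 : K))).
Hypotheses (chiB : bicharacter chi) (chiS : symmetric_bichar chi).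

Lemma bichar_integral a b : Zint (chi a b).
Proof.
exists ('X^#|A| - 1); first by apply: monicXnsubC; exact: cardA_gt0.
by rewrite rmorphB /= map_polyXn rmorph1 /root !hornerE bichar_card // subrr.
Qed.

Lemma integral_sum (I : finType) (P : pred I) (F : I -> K) :
  (forall i, P i -> Zint (F i)) -> Zint (\sum_(i | P i) F i).
Proof.
move=> FZ; elim/big_ind: _ => //; first exact: integral0.
exact: integral_add.
Qed.

Lemma path_sum_integral j y : Zint (path_sum chi j y).
Proof.
elim: j y => [|j IHj] y /=; first exact: integral1.
apply: integral_sum => x _; rewrite -bicharVl //.
by do 2![apply: integral_mul => //]; exact: bichar_integral.
Qed.

Lemma path_sumV j y : path_sum chi j y^-1%g = path_sum chi j y.
Proof.
elim: j y => [|j IHj] y //=; rewrite (reindex_inj invg_inj) /=.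
by apply: eq_bigr => x _; rewrite IHj !(bicharVl, bicharVr) // !invrK.
Qed.

(** In a group of odd order, only 1 is its own inverse. *)
Lemma sum_inv_double (h : A -> K) : odd #|A| -> (forall x, h x^-1%g = h x) ->
  \sum_(x | x != 1%g) h x = 2 * \sum_(x | (enum_rank x < enum_rank x^-1%g)%N) h x.
Proof.
move=> oA hV; rewrite mulr_natl mulr2n.
rewrite (bigID (fun x => enum_rank x < enum_rank x^-1%g)%N) /=; congr (_ + _).
  apply: eq_bigl => x; have [->|//] := eqVneq x 1%g.
  by rewrite invg1 ltnn.
rewrite [RHS](reindex_inj invg_inj) /=; apply: eq_big => [x|x _]; last by rewrite hV.
rewrite invgK -leqNgt leq_eqVlt; have [->|x1] /= := eqVneq x 1%g.
  by rewrite invg1 ltnn.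
case: eqP => //= /val_inj/enum_rank_inj xV; case/eqP: x1.
apply/eqP; rewrite -order_eq1 -dvdn1 -(eqP (_ : coprime #|A| 2)); last by rewrite coprimen2.
rewrite dvdn_gcd -{1}cardsT order_dvdG ?inE //= order_dvdn expgS expg1.
by rewrite -{1}xV mulVg.
Qed.

(** Modulo 2, only the constant path 1 contributes to the sum. *)
Lemma path_sum1_odd j : odd #|A| -> exists2 t, Zint t & path_sum chi j 1%g = 1 + 2 * t.
Proof.
move=> oA; elim: j => [|j [t tZ tE]] /=.
  by exists 0; [exact: integral0 | rewrite mulr0 addr0].
rewrite (bigD1 1%g) //= sum_inv_double //; last first.
  by move=> x; rewrite path_sumV !bichar1r // bicharVl // bicharVr // !invrK.
rewrite !bichar1l // invr1 !mul1r tE -addrA -mulrDr; eexists; last by [].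
apply: integral_add => //; apply: integral_sum => x _; rewrite -bicharVl //.
by apply: integral_mul (path_sum_integral _ _); apply: integral_mul; exact: bichar_integral.
Qed.

End IntegralPath.

(** * The torsion subgroups and the final count *)

Section Ldiv.
Variables (A : finGroupType).
Hypothesis abA : abelian [set: A].

Lemma group_set_Ldiv k : group_set ('Ldiv_k() : {set A})%g.
Proof. by have := group_Ldiv k abA; rewrite setTI. Qed.

(** The k-torsion of the abelian group A, as a subgroup. *)
Canonical Ldiv_group k := Group (group_set_Ldiv k).

Lemma card_quotient_Ldiv k :
  (#|([set: A] / 'Ldiv_k())%g| * #|('Ldiv_k() : {set A})%g| = #|A|)%N.
Proof.
have nL : (Ldiv_group k <| [set: A])%g by rewrite -sub_abelian_normal ?subsetT.
rewrite (card_quotient (normal_norm nL)) mulnC Lagrange ?subsetT // cardsT //.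
Qed.

(** x |-> x ^ k embeds the quotient of the 2k-torsion by the k-torsion into an
    elementary abelian 2-group. *)
Lemma card_Ldiv_double k :
  exists r, #|('Ldiv_(2 * k)() : {set A})%g| = (2 ^ r * #|('Ldiv_k() : {set A})%g|)%N.
Proof.
have sL : (Ldiv_group k \subset Ldiv_group (2 * k))%g.
  by apply/subsetP => a; rewrite !inE mulnC expgM => /eqP->; rewrite expg1n.
have nL : (Ldiv_group k <| Ldiv_group (2 * k))%g.
  by rewrite -sub_abelian_normal //; apply: abelianS abA; apply: subsetT.
have p2 : (2.-group (Ldiv_group (2 * k) / Ldiv_group k))%g.
  rewrite -pnat_exponent; apply: (@pnat_dvd _ 2) => //.
  apply/exponentP => _ /morphimP[a na aL ->].
  rewrite -morphX //; apply: coset_id; move: aL; rewrite !inE.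
  by rewrite expgM.
have [r rE] := p_natP p2.
by exists r; rewrite -rE card_quotient ?normal_norm // [RHS]mulnC Lagrange.
Qed.

Lemma card_Ldiv_dvd j : (#|('Ldiv_(j.+1)() : {set A})%g| %| #|A| ^ j)%N.
Proof.
case: j => [|j]; last by rewrite expnS dvdn_mulr // -(card_quotient_Ldiv j.+2) dvdn_mull.
suff -> : #|('Ldiv_1() : {set A})%g| = 1%N by [].
by rewrite -[RHS](cards1 (1%g : A)); apply: eq_card => a; rewrite !inE expg1.
Qed.

End Ldiv.

(** The statement over any algebraically closed numeric field, for a parameter tau
    of that field, with k = j + 1. *)
Theorem TY_ind_even (K : numClosedFieldType) (A : finGroupType) (chi : A -> A -> K)
    (tau : K) (j : nat) :
  abelian [set: A] ->
  bicharacter chi -> symmetric_bichar chi -> nondegenerate_bichar chi ->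
  tau ^+ 2 = #|A|%:R^-1 ->
  exists (r : nat) (xi : K),
    [/\ xi ^+ 8 = 1 \/ xi = 0,
        TY_ind chi tau (2 * j.+1)%N =
          (2 ^+ r + sqrtC #|([set: A] / 'Ldiv_(j.+1)())%g|%:R * xi)
          * #|('Ldiv_(j.+1)() : {set A})%g|%:R
      & odd #|A| ->
        r = 0%N /\
        xi ^+ 2 = (if (#|A| ^ j %/ #|('Ldiv_(j.+1)() : {set A})%g| == 1 %[mod 4])%N
                   then 1 else -1)].
Proof.
move=> abA chiB chiS chiN tauE.
have [r rE] := card_Ldiv_double abA j.+1.
have NE := card_quotient_Ldiv abA j.+1.
rewrite TY_indE // rE.
set L := #|('Ldiv_(j.+1)() : {set A})%g| in rE NE *.
set Q := #|(_ / _)%g| in NE *; set N := #|A| in rE NE tauE *.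
have N0 : N%:R != 0 :> K := natr_card_neq0 A K.
have Ngt : (0 < N)%N := cardA_gt0 A.
have [Qgt Lgt] : (0 < Q)%N /\ (0 < L)%N by apply/andP; rewrite -muln_gt0 NE.
have Q0 : Q%:R != 0 :> K by rewrite pnatr_eq0 -lt0n.
have L0 : L%:R != 0 :> K by rewrite pnatr_eq0 -lt0n.
have sq0 : sqrtC (Q%:R : K) != 0 by rewrite sqrtC_eq0.
have tau0 : tau != 0.
  by apply: contraNneq (invr_neq0 N0) => t0; rewrite -tauE t0 expr0n.
set s := path_sum chi j 1%g.
pose xi : K := tau^-1 * tau ^+ j * s / (sqrtC Q%:R * L%:R).
pose P := (N ^ j * L)%N.
have P0 : P%:R != 0 :> K by rewrite pnatr_eq0 -lt0n muln_gt0 expn_gt0 Ngt.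
have xi2 : xi ^+ 2 = s ^+ 2 / P%:R.
  have t1 : tau^-1 ^+ 2 = N%:R by rewrite exprVn tauE invrK.
  have tj : (tau ^+ j) ^+ 2 = (N%:R ^+ j)^-1 by rewrite exprAC tauE exprVn.
  rewrite /xi !exprMn t1 tj exprVn exprMn sqrtCK /P natrM natrX.
  by rewrite -{1}NE natrM; field; rewrite Q0 L0 expf_neq0.
exists r, xi; split.
- have [triv|] := boolP [forall a, ((a ^+ j.+1)%g == 1%g) ==> (chi a a ^+ 'C(j.+1, 2) == 1)].
    left; rewrite (exprM xi 2 4) xi2 exprMn exprVn.
    have sP : s * s^* = P%:R.
      rewrite -normCK path_sum1_norm // ?natrM ?natrX // 1?mulrC // => a /eqP a1.
      by have /forallP/(_ a) := triv; rewrite a1 => /eqP.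
    rewrite -exprM (exprD _ 4 4) {2}[s ^+ 4]path_sum1_quartic // -exprMn sP divff ?expf_neq0 //.
  rewrite negb_forall => /existsP[a]; rewrite negb_imply => /andP[/eqP a1 c1].
  by right; rewrite /xi /s (path_sum1_eq0 chiB chiS a1 c1) mulr0 mul0r.
- rewrite natrM natrX mulrDl; congr (_ + _).
  by rewrite -mulrA mulrCA mulrA /xi; field; rewrite tau0 L0 sq0.
move=> oN.
have oL : odd L by move: oN; rewrite -NE oddM => /andP[].
split.
  have : odd (2 ^ r * L).
    rewrite -rE; apply: dvdn_odd oN; rewrite /N -cardsT.
    exact: (cardSg (subsetT (Ldiv_group abA (2 * j.+1)))).
  by rewrite oddM oddX orbF => /andP[/eqP].
have [t tZ tE] := path_sum1_odd chiB chiS j oN.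
have oP : odd P by rewrite /P oddM oddX oN orbT.
have triv a : (a ^+ j.+1 = 1)%g -> chi a a ^+ 'C(j.+1, 2) = 1.
  move=> a1; set v := _ ^+ _.
  have v2 : v ^+ 2 = 1.
    by rewrite -exprM mulnC -mul_bin_diag bin1 exprM -bicharXl // a1 bichar1l // expr1n.
  have : v ^+ N = 1 by rewrite -exprM mulnC exprM bichar_card // expr1n.
  by rewrite -[N]odd_double_half oN exprD -mul2n exprM v2 expr1n mulr1.
have sP : s * s^* = P%:R.
  by rewrite -normCK path_sum1_norm // natrM natrX mulrC.
have s8 : s ^+ 8 = P%:R ^+ 4.
  by rewrite (exprD _ 4 4) {2}[s ^+ 4]path_sum1_quartic // -exprMn sP.
rewrite xi2 (odd_sqr tZ tE oP s8).
have [q qE] : exists q, (N ^ j = q * L)%N.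
  by apply/dvdnP; exact: card_Ldiv_dvd.
rewrite qE mulnK //.
have -> : (P == 1 %[mod 4])%N = (q == 1 %[mod 4])%N.
  have LL : (L * L = 1 %[mod 4])%N.
    have [l ->] : exists l, L = (l.*2 + 1)%N.
      by exists L./2; rewrite -[LHS]odd_double_half oL addnC.
    have -> : ((l.*2 + 1) * (l.*2 + 1) = (l * l + l) * 4 + 1)%N by rewrite -mul2n; ring.
    by rewrite modnMDl.
  by rewrite /P qE -mulnA -modnMmr LL modnMmr muln1.
by case: ifP => _; rewrite ?mulNr divff.
Qed.

Local Open Scope complex_scope.

Theorem theorem4p2 (R : realType) (A : finGroupType) (chi : A -> A -> R[i])
    (tau : R) (k : nat) :
  abelian [set: A] ->
  bicharacter chi -> symmetric_bichar chi -> nondegenerate_bichar chi ->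
  tau ^+ 2 = #|A|%:R^-1 ->
  (0 < k)%N ->
  exists (r : nat) (xi : R[i]),
    [/\ xi ^+ 8 = 1 \/ xi = 0,
        TY_ind chi tau%:C (2 * k)%N =
          (2 ^+ r + sqrtC #|([set: A] / 'Ldiv_k())%g|%:R * xi)
          * #|('Ldiv_k() : {set A})%g|%:R
      & odd #|A| ->
        r = 0%N /\
        xi ^+ 2 = (if (#|A| ^ k.-1 %/ #|('Ldiv_k() : {set A})%g| == 1 %[mod 4])%N
                   then 1 else -1)].
Proof.
move=> abA chiB chiS chiN tauE; case: k => // j _.
apply: (TY_ind_even j abA chiB chiS chiN).
by rewrite -rmorphXn /= tauE fmorphV rmorph_nat.
Qed.
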